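(* Let $\Sigma\subseteq N_{\mathbb{R}}$ be a simplicial $d$-fan, $*\in\mathrm{Inn}(N_{\mathbb{R}})$ an inner product, and $\omega:\Sigma(d)\rightarrow\mathbb{R}_{>0}$ a weight function. (1) For any $z_1,\dots,z_d\in\overline{\mathrm{Cub}}(\Sigma,* )$ and any permutation $\pi\in S_d$, $$\mathrm{MVol}_{\Sigma,\omega,*}(z_1,\dots,z_d)=\mathrm{MVol}_{\Sigma,\omega,*}(\pi(z_1,\dots,z_d)).$$ (2) For any $i=1,\dots,d$, and for any $z_1,\dots,z_i,z_i',\dots,z_d\in\overline{\mathrm{Cub}}(\Sigma,* )$ and $\lambda\in\mathbb{R}_{\geq 0}$, $$\mathrm{MVol}_{\Sigma,\omega,*}(z_1,\dots,\lambda z_i+z_i',\dots,z_d)=\lambda\, \mathrm{MVol}_{\Sigma,\omega,*}(z_1,\dots,z_i,\dots,z_d)+\mathrm{MVol}_{\Sigma,\omega,*}(z_1,\dots,z_i',\dots,z_d).$$ (3) For any $z\in\overline{\mathrm{Cub}}(\Sigma,* )$, $$\mathrm{MVol}_{\Sigma,\omega,*}(z,\dots,z)=\mathrm{Vol}_{\Sigma,\omega,*}(z).$$ Moreover, any function $\overline{\mathrm{Cub}}(\Sigma,* )^d\rightarrow\mathbb{R}_{\geq 0}$ satisfying Properties (1)–(3) (in place of $\mathrm{MVol}_{\Sigma,\omega,*}$) must be $\mathrm{MVol}_{\Sigma,\omega,*}$.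
   Context: **Fans.** $N_{\mathbb{R}}$ is a finite-dimensional real vector space. All fans are (finite) polyhedral fans that are pure (all maximal cones have the same dimension) and marked (a generator $0\neq u_\rho\in\rho$ is chosen for each ray $\rho$). A $d$-fan is such a fan of dimension $d$. $\Sigma(k)$ is the set of $k$-dimensional cones, $\sigma(1)$ the set of rays of $\sigma$, $N_{\sigma,\mathbb{R}}$ the linear span of $\sigma$. $\Sigma$ is simplicial if $\dim N_{\sigma,\mathbb{R}}=|\sigma(1)|$ for all $\sigma\in\Sigma$. $\mathrm{Inn}(N_{\mathbb{R}})$ is the set of inner products on $N_{\mathbb{R}}$. **Pseudocubical values.** For $z\in\mathbb{R}^{\Sigma(1)}$ and $\sigma\in\Sigma$, $w_{\sigma,*}(z)\in N_{\sigma,\mathbb{R}}$ is the unique vector with $w_{\sigma,*}(z)*u_\rho=z_\rho$ for all $\rho\in\sigma(1)$. $\overline{\mathrm{Cub}}(\Sigma,* )$ is the set of $z$ with $w_{\sigma,*}(z)\in\sigma$ for all $\sigma\in\Sigma$; it is a polyhedral cone. **(Mixed) volumes.** Let $P_{\sigma,*}(z)=\{v\in\sigma\mid v*u_\rho\le z_\rho\text{ for all }\rho\in\sigma(1)\}$. Let $M_\sigma\subseteq N_{\sigma,\mathbb{R}}$ be the lattice spanned by the basis dual to $\{u_\rho\mid\rho\in\sigma(1)\}$ with respect to $*$; $\mathrm{Vol}_\sigma$ is the volume on polytopes in $N_{\sigma,\mathbb{R}}$ normalized so that a fundamental simplex of $M_\sigma$ (convex hull of $0$ and a lattice basis) has volume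 $1$, and $\mathrm{MVol}_\sigma$ is the associated (Minkowski) mixed volume of polytopes (symmetric, multilinear with respect to nonnegative Minkowski combinations, $\mathrm{MVol}_\sigma(P,\dots,P)=\mathrm{Vol}_\sigma(P)$). For pseudocubical values, $$\mathrm{Vol}_{\Sigma,\omega,*}(z)=\sum_{\sigma\in\Sigma(d)}\omega(\sigma)\mathrm{Vol}_\sigma(P_{\sigma,*}(z)),$$ $$\mathrm{MVol}_{\Sigma,\omega,*}(z_1,\dots,z_d)=\sum_{\sigma\in\Sigma(d)}\omega(\sigma)\mathrm{MVol}_\sigma(P_{\sigma,*}(z_1),\dots,P_{\sigma,*}(z_d)).$$ *)

(* Defs.v *)
From HB Require Import structures.
From mathcomp Require Import all_boot all_order all_fingroup all_algebra.
From mathcomp Require Import finmap.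
From mathcomp Require Import all_classical all_reals all_analysis.

Set Implicit Arguments.
Unset Strict Implicit.
Unset Printing Implicit Defensive.
Import Order.TTheory GRing.Theory Num.Theory.

Local Open Scope classical_set_scope.
Local Open Scope ring_scope.

(* Lebesgue measure on R^n as an iterated integral (Tonelli); the successor case
   is the formula defining the library's binary product measure. *)
Fixpoint lebesgue_iter (R : realType) (n : nat) : set (n.-tuple R) -> \bar R :=
  match n with
  | 0 => fun A => \d_[tuple] A
  | n'.+1 => fun A =>
      (\int[lebesgue_measure]_(x in [set: R])
         lebesgue_iter [set t : n'.-tuple R | A (cons_tuple x t)])%E
  end.

Section Convexity.
Variables (R : realType) (N : vectType R).

Definition conic_hull (s : seq N) : set N :=
  [set \sum_(i < size s) c i *: s`_i
    | c in [set c : 'I_(size s) -> R | forall i, 0 <= c i]].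

Definition convex_hull (s : seq N) : set N :=
  [set \sum_(i < size s) c i *: s`_i
    | c in [set c : 'I_(size s) -> R | (forall i, 0 <= c i) /\ \sum_i c i = 1]].

Definition polyhedral_cone (C : set N) : Prop :=
  exists s : seq N, C = conic_hull s.

Definition strongly_convex (C : set N) : Prop :=
  forall v, C v -> C (- v) -> v = 0.

Definition convex_cone (C : set N) : Prop :=
  C 0 /\ forall (a b : R) v w, 0 <= a -> 0 <= b -> C v -> C w ->
    C (a *: v + b *: w).

(* Faces in the sense of convex geometry: t contains every segment of C whose
   relative interior meets t. For polyhedral cones these are exactly the
   intersections of C with its supporting hyperplanes, and C itself. *)
Definition is_face (t C : set N) : Prop :=
  [/\ convex_cone t, t `<=` C &
      forall v w, C v -> C w -> t (v + w) -> t v /\ t w].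

Definition lin_span (C : set N) : {vspace N} :=
  xget 0%VS [set V : {vspace N} | C `<=` [set` V] /\
    forall W : {vspace N}, C `<=` [set` W] -> (V <= W)%VS].

Definition cone_dim (C : set N) : nat := \dim (lin_span C).

Definition cones_of_dim (F : set (set N)) (k : nat) : set (set N) :=
  [set s | F s /\ cone_dim s = k].

Definition minkowski_comb (a b : R) (P Q : set N) : set N :=
  [set a *: v + b *: w | v in P & w in Q].

(* Polytopes are nonempty. *)
Definition polytope_in (V : {vspace N}) (P : set N) : Prop :=
  exists s : seq N, [/\ s != [::], {subset s <= V} & P = convex_hull s].

(* Volume on the span of the linearly independent family b, normalized so that
   the convex hull of 0 and b, of Lebesgue measure 1 / (size b)! in the
   coordinates given by b, has volume 1. *)
Definition normalized_volume (b : seq N) (P : set N) : R :=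
  (size b)`!%:R * fine (lebesgue_iter
    [set t : (size b).-tuple R | P (\sum_(i < size b) tnth t i *: b`_i)]).

Definition is_mixed_volume (d : nat) (V : {vspace N}) (vol : set N -> R)
    (F : ('I_d -> set N) -> R) : Prop :=
  [/\ forall (P : 'I_d -> set N) (p : 'S_d),
        (forall i, polytope_in V (P i)) -> F (P \o p) = F P,
      forall (P : 'I_d -> set N) (i : 'I_d) (Q : set N) (a b : R),
        (forall j, polytope_in V (P j)) -> polytope_in V Q ->
        0 <= a -> 0 <= b ->
        F [eta P with i |-> minkowski_comb a b (P i) Q] =
        a * F P + b * F [eta P with i |-> Q] &
      forall P, polytope_in V P -> F (fun=> P) = vol P].

(* By polarization, is_mixed_volume determines F on tuples of polytopes. *)
Definition mixed_volume (d : nat) (V : {vspace N}) (vol : set N -> R) :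
    ('I_d -> set N) -> R :=
  xget (fun=> 0) [set F | is_mixed_volume V vol F].

End Convexity.

Record marked_fan (R : realType) (N : vectType R) := MarkedFan {
  cones : set (set N) ;
  cones_finite : finite_set cones ;
  cones_nonempty : cones !=set0 ;
  cones_polyhedral : forall s, cones s -> polyhedral_cone s ;
  cones_strongly_convex : forall s, cones s -> strongly_convex s ;
  cones_face : forall s t, cones s -> is_face t s -> cones t ;
  cones_meet : forall s t, cones s -> cones t ->
    is_face (s `&` t) s /\ is_face (s `&` t) t ;
  mark : cones_of_dim cones 1 -> N ;
  mark_neq0 : forall rho, mark rho != 0 ;
  mark_in : forall rho, val rho (mark rho)
}.

Section Fans.
Variables (R : realType) (N : vectType R) (Sigma : marked_fan N).

Definition ray : Type := cones_of_dim (cones Sigma) 1.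
HB.instance Definition _ := Choice.on ray.

Definition rays_of (s : set N) : set ray := [set rho | is_face (val rho) s].

Definition d_fan (d : nat) : Prop :=
  forall s, cones Sigma s ->
    (forall t, cones Sigma t -> s `<=` t -> t = s) -> cone_dim s = d.

Definition simplicial : Prop :=
  forall s, cones Sigma s -> (rays_of s #= `I_(cone_dim s))%card.

Variable ip : {dot N for idfun}.

(* Exists and is unique for a cone s of a simplicial fan. *)
Definition cub_vector (s : set N) (z : ray -> R) : N :=
  xget 0 [set w | w \in lin_span s /\
    forall rho, rays_of s rho -> ip w (mark rho) = z rho].

Definition pseudocubical : set (ray -> R) :=
  [set z | forall s, cones Sigma s -> s (cub_vector s z)].

Definition cub_polytope (s : set N) (z : ray -> R) : set N :=
  [set v | s v /\ forall rho, rays_of s rho -> ip v (mark rho) <= z rho].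

(* The basis of lin_span s dual, with respect to ip, to the markings of the rays
   of s, in an arbitrary order. *)
Definition dual_basis (s : set N) : seq N :=
  [seq cub_vector s (fun rho' => (rho' == rho)%:R) | rho <- fset_set (rays_of s)].

Definition vol_cone (s : set N) : set N -> R := normalized_volume (dual_basis s).

Definition mvol_cone (d : nat) (s : set N) : ('I_d -> set N) -> R :=
  mixed_volume (lin_span s) (vol_cone s).

Variables (d : nat) (omega : cones_of_dim (cones Sigma) d -> R).

Definition vol_fan (z : ray -> R) : R :=
  \sum_(s \in [set: cones_of_dim (cones Sigma) d])
    omega s * vol_cone (val s) (cub_polytope (val s) z).

Definition mvol_fan (z : 'I_d -> ray -> R) : R :=
  \sum_(s \in [set: cones_of_dim (cones Sigma) d])
    omega s * mvol_cone (val s) (fun i => cub_polytope (val s) (z i)).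

Definition cub_symmetric (F : ('I_d -> ray -> R) -> R) : Prop :=
  forall (z : 'I_d -> ray -> R) (p : 'S_d),
    (forall i, pseudocubical (z i)) -> F z = F (z \o p).

Definition cub_multilinear (F : ('I_d -> ray -> R) -> R) : Prop :=
  forall (i : 'I_d) (z : 'I_d -> ray -> R) (z' : ray -> R) (lambda : R),
    (forall j, pseudocubical (z j)) -> pseudocubical z' -> 0 <= lambda ->
    F [eta z with i |-> lambda *: z i + z'] =
    lambda * F z + F [eta z with i |-> z'].

Definition cub_diagonal (F : ('I_d -> ray -> R) -> R) : Prop :=
  forall z : ray -> R, pseudocubical z -> F (fun=> z) = vol_fan z.

End Fans.

(* Main.v *)
(* Minkowski's theorem is proved by the Cayley trick: after lifting the vertices with
   a generic linear-programming cost, the dual feasible bases cut a weighted sum of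
   polytopes into cells, indexed independently of the weights, that overlap in null
   sets. Each cell is an affine image of a fixed one, of volume a monomial in the
   weights, also when some weights vanish. So the volume of the weighted sum is a
   homogeneous polynomial, and its polarization is a mixed volume.

   On a cone s of the fan, a pseudocubical z has the face points w_t(z), linear in z,
   and P_s(z) is their convex hull: the ray from w_s(z) through a point of P_s(z) can
   leave P_s(z) only through a proper face of s. Hence P_s is additive in z, which
   transfers the mixed volume axioms to the fan. Uniqueness is polarization on the
   convex cone of pseudocubical values. *)
Require Import Defs.
From HB Require Import structures.
From mathcomp Require Import all_boot all_order all_fingroup all_algebra.
From mathcomp Require Import finmap.
From mathcomp Require Import all_classical all_reals all_analysis.
From mathcomp Require Import measurable_realfun ring lra.

Set Implicit Arguments.
Unset Strict Implicit.
Unset Printing Implicit Defensive.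
Import Order.TTheory GRing.Theory Num.Theory.
Import numFieldNormedType.Exports.

Local Open Scope classical_set_scope.
Local Open Scope ring_scope.

(** * Lebesgue measure on tuples *)

(** [mixed_volume] is a choice that falls back to the zero function, so the diagonal property of
    [mvol_fan] requires a witness for [is_mixed_volume]. Polarization evaluates volumes of sums with
    weights 0 and 1, so the volume polynomial must be valid on the closed orthant of weights, and
    also for polytopes of lower dimension. The Cayley embedding suits this because the weights only
    select a slice of one fixed family of simplicial cones. The delicate case is a basis in which
    some label occurs exactly once: the corresponding coordinate equals the weight on the whole
    slice, so its vanishing does not cut out a hyperplane. Both the volume of a cell and the nullity
    of overlaps need a separate argument for such labels. *)

Section LebesgueTuple.
Variable R : realType.
Local Notation T := (measurableTypeR R).
Local Notation leb := (@lebesgue_measure R).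

Definition cons_pair n (p : T * n.-tuple T) : n.+1.-tuple T :=
  cons_tuple p.1 p.2.

Definition uncons n (t : n.+1.-tuple T) : T * n.-tuple T :=
  (thead t, [tuple of behead t]).

Lemma measurable_cons_pair n : measurable_fun [set: T * n.-tuple T] (@cons_pair n).
Proof. exact: (measurable_cons measurable_fst measurable_snd). Qed.

Lemma measurable_uncons n : measurable_fun setT (@uncons n).
Proof.
exact: (measurable_fun_pair (measurable_tnth ord0) (@measurable_behead _ _ _)).
Qed.

Lemma cons_pairK n : cancel (@cons_pair n) (@uncons n).
Proof. by move=> [x t]; congr pair; exact/val_inj. Qed.

Section ConsMeasure.
Variables (n : nat) (m : {sigma_finite_measure set (n.-tuple T) -> \bar R}).

Definition cons_measure : set (n.+1.-tuple T) -> \bar R :=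
  pushforward (leb \x m)%E (@cons_pair n).

Let M : {measure set (n.+1.-tuple T) -> \bar R} :=
  measure_function_pushforward__canonical__measure_function_Measure
    [the measure _ _ of (leb \x m)%E] (@measurable_cons_pair n).

Let cm0 : cons_measure set0 = 0%E.
Proof. exact: (measure0 M). Qed.

Let cm_ge0 A : (0 <= cons_measure A)%E.
Proof. exact: (measure_ge0 M). Qed.

Let cm_sigma_additive : semi_sigma_additive cons_measure.
Proof. exact: (@measure_semi_sigma_additive _ _ _ M). Qed.

HB.instance Definition _ := isMeasure.Build _ _ _ cons_measure
  cm0 cm_ge0 cm_sigma_additive.

Let cm_sigma_finite : sigma_finite setT cons_measure.
Proof.
have /sigma_finiteP[F [TF ndF Foo]] := @sigma_finiteT _ _ _ leb.
have /sigma_finiteP[G [TG ndG Goo]] := @sigma_finiteT _ _ _ m.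
exists (fun k => @uncons n @^-1` (F k `*` G k)).
  apply/seteqP; split=> // t _.
  have [i _ Fi] : (\bigcup_i F i) (thead t) by rewrite -TF.
  have [j _ Gj] : (\bigcup_i G i) [tuple of behead t] by rewrite -TG.
  exists (maxn i j) => //; split => /=.
  - by move: Fi; apply/subsetPset/ndF/leq_maxl.
  - by move: Gj; apply/subsetPset/ndG/leq_maxr.
move=> k; have [mF Fk] := Foo k; have [mG Gk] := Goo k; split.
  rewrite -[X in measurable X]setTI; apply: measurable_uncons => //.
  exact: measurableX.
rewrite /cons_measure /pushforward -comp_preimage.
rewrite (_ : _ \o _ = id); last by apply/funext => p; rewrite /= cons_pairK.
by rewrite preimage_id product_measure1E// lte_mul_pinfty// ge0_fin_numE.
Qed.

HB.instance Definition _ := Measure_isSigmaFinite.Build _ _ _ cons_measure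
  cm_sigma_finite.

End ConsMeasure.

(** The recursion of [lebesgue_iter], bundled as a sigma-finite measure so that additivity and
    Tonelli apply. *)
Fixpoint leb_tuple n : {sigma_finite_measure set (n.-tuple T) -> \bar R} :=
  match n with
  | 0 => [the {sigma_finite_measure set (0.-tuple T) -> \bar R} of \d_([tuple] : 0.-tuple T)]
  | n'.+1 => [the {sigma_finite_measure set (n'.+1.-tuple T) -> \bar R} of
      cons_measure (leb_tuple n')]
  end.

End LebesgueTuple.

Section LebesgueTupleTheory.
Variable R : realType.
Local Notation T := (measurableTypeR R).
Local Notation leb := (@lebesgue_measure R).

Lemma leb_tupleS n (A : set (n.+1.-tuple T)) :
  leb_tuple R n.+1 A = (\int[leb]_x leb_tuple R n [set t | A (cons_tuple x t)])%E.
Proof.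
apply: eq_integral => x _ /=; congr (leb_tuple R n _).
by rewrite xsectionE.
Qed.

Lemma lebesgue_iterE n (A : set (n.-tuple R)) : lebesgue_iter A = leb_tuple R n A.
Proof.
elim: n => [//|n IHn] in A *.
by rewrite leb_tupleS; apply: eq_integral => x _; exact: IHn.
Qed.

(** The integral of a nonnegative function is a supremum over simple functions below it, so
    monotonicity requires no measurability. *)
Lemma leb_integral_mono (f g : R -> \bar R) : (forall x, (0 <= f x)%E) ->
  (forall x, (f x <= g x)%E) ->
  (\int[leb]_(x in setT) f x <= \int[leb]_(x in setT) g x)%E.
Proof.
move=> f0 fg.
rewrite !ge0_integralTE//; last by move=> x; exact: le_trans (fg x).
apply: le_ereal_sup => _ /= [h hf <-]; exists h => // x.
exact: le_trans (hf x) (fg x).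
Qed.

Lemma lebesgue_iter_ge0 n (A : set (n.-tuple R)) : (0 <= lebesgue_iter A)%E.
Proof. by elim: n => [//|n IHn] in A *; exact: integral_ge0. Qed.

(* No measurability is assumed, so that subsets of null sets are null. *)
Lemma lebesgue_iter_mono n (A B : set (n.-tuple R)) : A `<=` B ->
  (lebesgue_iter A <= lebesgue_iter B)%E.
Proof.
elim: n => [|n IHn] in A B * => AB.
  rewrite /= !diracE lee_fin ler_nat.
  by case: (boolP (_ \in A)) => // /set_mem/AB/mem_set ->.
apply: leb_integral_mono => x; first exact: lebesgue_iter_ge0.
by apply: IHn => t /AB.
Qed.

(** Uniqueness of Lebesgue measure: the pushforward under the affine map, rescaled by [|a|], gives
    every interval []u, v]] its length. For negative [a] the preimage of such an interval is
    half-open at the other end. *)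
Lemma leb_affine (a b : R) (A : set R) : a != 0 -> measurable A ->
  leb [set x | A (a * x + b)] = (`|a|^-1%:E * leb A)%E.
Proof.
move=> a0 mA.
have mf : measurable_fun [set: T] (fun x : T => a * x + b : T).
  by apply: measurable_funD => //; exact: measurable_funM.
have na : 0 <= `|a| by [].
pose mu : {measure set T -> \bar R} := mscale (NngNum na)
  (measure_function_pushforward__canonical__measure_function_Measure leb mf).
have muE B : mu B = (`|a|%:E * leb [set x | B (a * x + b)%R])%E by [].
suff -> : leb A = mu A.
  by rewrite muE muleA -EFinM mulVf ?normr_eq0// mul1e.
apply: lebesgue_measure_unique => // _ [[u v] _ <-].
rewrite muE.
have [a_gt0|a_lt0|/eqP] := ltgtP 0 a; last by rewrite eq_sym (negbTE a0).
- rewrite (_ : [set x | [set` `]u, v]] (a * x + b)] = [set` `](u - b) / a, (v - b) / a]]); last first.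
    apply/seteqP; split=> x /=; rewrite !in_itv/= ltr_pdivrMr// ler_pdivlMr//;
    by rewrite ltrBlDr lerBrDr mulrC.
  rewrite !lebesgue_measure_itv /= !lte_fin ltr_pM2r ?invr_gt0// ltrD2r.
  case: ifP => _; last by rewrite mule0.
  rewrite -!EFinD -EFinM gtr0_norm//; congr EFin; field.
  by rewrite gt_eqF.
- rewrite (_ : [set x | [set` `]u, v]] (a * x + b)] = [set` `[(v - b) / a, (u - b) / a[]); last first.
    apply/seteqP; split=> x /=; rewrite !in_itv/= ltr_ndivlMr// ler_ndivrMr//;
    by rewrite ltrBlDr lerBrDr mulrC andbC.
  rewrite !lebesgue_measure_itv /= !lte_fin ltr_nM2r ?invr_lt0// ltrD2r.
  case: ifP => _; last by rewrite mule0.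
  rewrite -!EFinD -EFinM ltr0_norm//; congr EFin; field.
  by rewrite lt_eqF.
Qed.

Definition rowt n (t : n.-tuple R) : 'rV[R]_n := \row_j tnth t j.
Definition tupr n (u : 'rV[R]_n) : n.-tuple R := [tuple u 0 i | i < n].

Lemma tuprK n : cancel (@tupr n) (@rowt n).
Proof. by move=> u; apply/rowP => i; rewrite mxE tnth_mktuple. Qed.

Definition affmap n (M : 'M[R]_n) (v : 'rV_n) (t : n.-tuple T) : n.-tuple T :=
  tupr (rowt t *m M + v).

Lemma measurable_affmap n (M : 'M[R]_n) (v : 'rV_n) :
  measurable_fun setT (affmap M v).
Proof.
apply/measurable_fun_tnthP => i.
rewrite (_ : _ \o _ =
    fun t : n.-tuple T => (\sum_(j < n) tnth t j * M j i) + v 0 i : T); last first.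
  apply/funext => t; rewrite /= tnth_mktuple !mxE; congr (_ + _).
  by apply: eq_bigr => j _; rewrite mxE.
apply: measurable_funD => //; apply: measurable_sum => j.
by apply: measurable_funM => //; exact: measurable_tnth.
Qed.

(** Preimages are measured, so [c] is the inverse of the Jacobian. Bundling measurability makes the
    notion stable under composition. *)
Definition scales_by (c : R) n (f : n.-tuple T -> n.-tuple T) : Prop :=
  measurable_fun setT f /\
  forall A, measurable A -> leb_tuple R n (f @^-1` A) = (c%:E * leb_tuple R n A)%E.

Lemma scales_by_comp b c n (f g : n.-tuple T -> n.-tuple T) :
  scales_by b f -> scales_by c g -> scales_by (b * c) (g \o f).
Proof.
move=> [mf hf] [mg hg]; split; first exact: measurableT_comp.
move=> A mA; rewrite comp_preimage hf ?hg ?EFinM ?muleA//.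
by rewrite -[X in measurable X]setTI; exact: mg.
Qed.

Definition ttail n (t : n.+1.-tuple T) : n.-tuple T := [tuple of behead t].

Lemma ttail_cons n x (t : n.-tuple T) : ttail (cons_tuple x t) = t.
Proof. exact/val_inj. Qed.

(** Tonelli with the first coordinate outermost: [f] fixes it and scales every fibre by the same
    factor. *)
Lemma scales_by_fiber c n (g : R -> n.-tuple T -> n.-tuple T)
    (f := fun t : n.+1.-tuple T => cons_tuple (thead t) (g (thead t) (ttail t))) :
  measurable_fun setT f -> (forall x, scales_by c (g x)) -> 0 <= c -> scales_by c f.
Proof.
move=> mf hg c0; split=> // A mA.
have mAx x : measurable [set t | A (cons_tuple x t)].
  rewrite -[X in measurable X]setTI.
  exact: (measurable_cons (@measurable_cst _ _ _ _ _ x) (@measurable_id _ _ _)).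
rewrite !leb_tupleS -ge0_integralZl//; last first.
  have := @measurable_fun_xsection _ _ _ _ _ (leb_tuple R n) (@cons_pair R n @^-1` A).
  rewrite (_ : _ \o _ = fun x => leb_tuple R n [set t | A (cons_tuple x t)]).
    by apply; rewrite -[X in measurable X]setTI; exact: measurable_cons_pair.
  by apply/funext => x /=; rewrite xsectionE.
apply: eq_integral => x _; have [_ <-//] := hg x.
by congr (leb_tuple R n _); apply/seteqP; split=> t; rewrite /f /= ttail_cons.
Qed.

Lemma leb_tupleS_tail n (A : set (n.+1.-tuple T)) : measurable A ->
  leb_tuple R n.+1 A = (\int[leb_tuple R n]_t leb [set x | A (cons_tuple x t)])%E.
Proof.
move=> mA; have mB : measurable (@cons_pair R n @^-1` A).
  by rewrite -[X in measurable X]setTI; exact: measurable_cons_pair.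
have := indic_fubini_tonelli leb (leb_tuple R n) mB.
rewrite indic_fubini_tonelli_FE// indic_fubini_tonelli_GE//.
rewrite -[X in X = _ -> _]/(leb_tuple R n.+1 A) => ->.
by apply: eq_integral => t _; rewrite /= ysectionE.
Qed.

(** Tonelli with the tail outermost: on each line the map is affine in one variable, with slope
    [a]. *)
Lemma scales_by_shear n a (phi : n.-tuple T -> T) : a != 0 ->
  measurable_fun setT phi ->
  scales_by `|a|^-1 (fun t => cons_tuple (a * thead t + phi (ttail t)) (ttail t)).
Proof.
move=> a0 mphi; set f := (X in scales_by _ X).
have mf : measurable_fun setT f.
  apply: measurable_cons; last exact: measurable_behead.
  apply: measurable_funD.
    by apply: measurable_funM => //; exact: measurable_tnth.
  by apply: measurableT_comp => //; exact: measurable_behead.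
split=> // A mA.
have mAt t : measurable [set x : T | A (cons_tuple x t)].
  rewrite -[X in measurable X]setTI.
  exact: (measurable_cons (@measurable_id _ _ _) (@measurable_cst _ _ _ _ _ t)).
have mfA : measurable (f @^-1` A) by rewrite -[X in measurable X]setTI; exact: mf.
rewrite !leb_tupleS_tail// -ge0_integralZl//; last first.
  have := @measurable_fun_ysection _ _ _ _ _ leb (@cons_pair R n @^-1` A).
  rewrite (_ : _ \o _ = fun t => leb [set x | A (cons_tuple x t)]).
    by apply; rewrite -[X in measurable X]setTI; exact: measurable_cons_pair.
  by apply/funext => t /=; rewrite ysectionE.
apply: eq_integral => t _; rewrite -(leb_affine (phi t) a0); last exact: mAt.
by congr (leb _); apply/seteqP; split=> x; rewrite /f /= ttail_cons.
Qed.

Definition tswap n (t : n.+2.-tuple T) : n.+2.-tuple T :=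
  cons_tuple (thead (ttail t)) (cons_tuple (thead t) (ttail (ttail t))).

Lemma scales_by_tswap n : scales_by 1 (@tswap n).
Proof.
have mf : measurable_fun setT (@tswap n).
  apply: measurable_cons.
    apply: (measurableT_comp (measurable_tnth ord0)); exact: measurable_behead.
  apply: measurable_cons; first exact: measurable_tnth.
  by apply: measurableT_comp; exact: measurable_behead.
split=> // A mA; rewrite mul1e !leb_tupleS.
pose c3 (p : T * T * n.-tuple T) : n.+2.-tuple T :=
  cons_tuple p.1.1 (cons_tuple p.1.2 p.2).
have mc3 : measurable_fun setT c3.
  apply: measurable_cons; first exact: (measurableT_comp measurable_fst measurable_fst).
  apply: measurable_cons; last exact: measurable_snd.
  exact: (measurableT_comp measurable_snd measurable_fst).
pose h (p : T * T) : \bar R :=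
  leb_tuple R n [set t | A (cons_tuple p.1 (cons_tuple p.2 t))].
have mh : measurable_fun setT h.
  have := @measurable_fun_xsection _ _ _ _ _ (leb_tuple R n) (c3 @^-1` A).
  rewrite (_ : _ \o _ = h).
    by apply; rewrite -[X in measurable X]setTI; exact: mc3.
  by apply/funext => x /=; rewrite xsectionE.
have h0 p : (0 <= h p)%E by exact: measure_ge0.
have := @fubini_tonelli1 _ _ _ _ _ leb leb h mh h0; rewrite fubini_tonelli2// => E.
transitivity (\int[leb]_y fubini_G leb h y)%E; last first.
  by rewrite E; apply: eq_integral => x _; rewrite leb_tupleS.
apply: eq_integral => x _; rewrite leb_tupleS; apply: eq_integral => y _.
by congr (leb_tuple R n _); apply/seteqP; split=> t; rewrite /tswap /= !ttail_cons.
Qed.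

End LebesgueTupleTheory.

(** * Affine changes of variables, null hyperplanes and bounded boxes *)

Section LinearChangeOfVariables.
Variable R : realType.
Local Notation T := (measurableTypeR R).
Local Notation leb := (@lebesgue_measure R).

Definition tpermute n (s : 'S_n) (t : n.-tuple T) : n.-tuple T :=
  [tuple tnth t (s k) | k < n].

Lemma measurable_tpermute n (s : 'S_n) : measurable_fun setT (tpermute s).
Proof.
apply/measurable_fun_tnthP => k.
rewrite (_ : _ \o _ = fun t : n.-tuple T => tnth t (s k)).
  exact: measurable_tnth.
by apply/funext => t /=; rewrite tnth_mktuple.
Qed.

Lemma scales_by_id n : scales_by 1 (@id (n.-tuple T)).
Proof. by split=> [|A mA]; [exact: measurable_id | rewrite preimage_id mul1e]. Qed.

Lemma tnth_cons0 (A : Type) n (x : A) (t : n.-tuple A) : tnth (cons_tuple x t) ord0 = x.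
Proof. by []. Qed.

Lemma tnth_consS (A : Type) n (x : A) (t : n.-tuple A) i :
  tnth (cons_tuple x t) (lift ord0 i) = tnth t i.
Proof. exact: tnthS. Qed.

Lemma tnth_ttail n (t : n.+1.-tuple T) i : tnth (ttail t) i = tnth t (lift ord0 i).
Proof. by rewrite [in RHS](tuple_eta t) tnthS. Qed.

(** Serves to move a pivot into the corner. The index is brought to the front of the tail by
    induction, then the first two coordinates are swapped. *)
Lemma scales_by_bring_to_front n (i : 'I_n.+1) :
  exists2 s : 'S_n.+1, s ord0 = i & scales_by 1 (tpermute s).
Proof.
elim: n i => [|n IHn] i; (case: (unliftP ord0 i) => [j|] ->; last first).
1,3: exists 1%g; rewrite ?perm1// (_ : tpermute _ = id); first exact: scales_by_id.
1,2: by apply/funext => t; apply: eq_from_tnth => k; rewrite tnth_mktuple perm1.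
- by case: j.
have [s s0 hs] := IHn j.
exists (tperm ord0 (lift ord0 ord0) * lift0_perm s)%g.
  by rewrite permM tpermL lift0_perm_lift s0.
rewrite -[1]mulr1.
rewrite (_ : tpermute _ = @tswap R n \o tpermute (lift0_perm s)).
  apply: scales_by_comp; last exact: scales_by_tswap.
  have -> : tpermute (lift0_perm s) = fun t : n.+2.-tuple T =>
      cons_tuple (thead t) (tpermute s (ttail t)).
    apply/funext => t; apply: eq_from_tnth => k; rewrite tnth_mktuple.
    case: (unliftP ord0 k) => [k'|] ->; last by rewrite lift0_perm0.
    by rewrite lift0_perm_lift tnth_consS tnth_mktuple tnth_ttail.
  apply: (@scales_by_fiber _ _ _ (fun _ => tpermute s)) => //.
  apply: measurable_cons; first exact: measurable_tnth.
  by apply: measurableT_comp; [exact: measurable_tpermute|exact: measurable_behead].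
apply/funext => t; apply: eq_from_tnth => k; rewrite tnth_mktuple permM /tswap /=.
have h0 u : thead u = tnth u ord0 by [].
case: (unliftP ord0 k) => [k'|] ->; last first.
  by rewrite tpermL lift0_perm_lift tnth_cons0 h0 tnth_ttail tnth_mktuple lift0_perm_lift.
rewrite tnth_consS; case: (unliftP ord0 k') => [k''|] ->; last first.
  by rewrite tpermR lift0_perm0 tnth_cons0 h0 tnth_mktuple lift0_perm0.
by rewrite tpermD// tnth_consS !tnth_ttail tnth_mktuple.
Qed.

Lemma affmap_row_perm n (s : 'S_n) (M : 'M[R]_n) v :
  affmap M v = affmap (row_perm s M) v \o tpermute s.
Proof.
apply/funext => t; rewrite /affmap /=; congr (tupr (_ + _)).
apply/rowP => j; rewrite !mxE (reindex_perm s) /=; apply: eq_bigr => i _.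
by rewrite !mxE tnth_mktuple.
Qed.

Lemma affmap_block n (a : R) (u : 'rV[R]_n) (w : 'cV[R]_n) (W : 'M[R]_n)
    (v0 : R) (v : 'rV[R]_n) (t : (1 + n).-tuple T) :
  affmap (block_mx a%:M u w W) (row_mx v0%:M v) t =
  cons_tuple (a * thead t + ((rowt (ttail t) *m w) 0 0 + v0))
    (tupr (thead t *: u + rowt (ttail t) *m W + v)).
Proof.
have tE : rowt t = row_mx (thead t)%:M (rowt (ttail t)).
  apply/rowP => k; rewrite mxE; case: (splitP k) => k' E.
    rewrite (_ : k = lshift n k'); last exact/val_inj.
    by rewrite row_mxEl (ord1 k') mxE eqxx mulr1n; congr tnth; exact/val_inj.
  rewrite (_ : k = rshift 1 k'); last exact/val_inj.
  by rewrite row_mxEr mxE tnth_ttail; congr tnth; exact/val_inj.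
rewrite /affmap tE mul_row_block add_row_mx; apply: eq_from_tnth => k; rewrite tnth_mktuple.
case: (unliftP ord0 k) => [k'|] ->.
  rewrite tnth_consS tnth_mktuple (_ : lift _ _ = rshift 1 k'); last exact/val_inj.
  by rewrite row_mxEr mul_scalar_mx.
rewrite tnth_cons0.
have -> : (ord0 : 'I_n.+1) = lshift n (ord0 : 'I_1) by exact/val_inj.
by rewrite row_mxEl -scalar_mxM !mxE !eqxx !mulr1n addrA mulrC.
Qed.

Lemma measurable_dot n (w : 'cV[R]_n) :
  measurable_fun setT (fun t : n.-tuple T => (rowt t *m w) 0 0 : T).
Proof.
rewrite (_ : (fun t => _) = fun t : n.-tuple T => \sum_(j < n) tnth t j * w j 0).
  by apply: measurable_sum => j; apply: measurable_funM => //; exact: measurable_tnth.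
by apply/funext => t; rewrite mxE; apply: eq_bigr => j _; rewrite mxE.
Qed.

(** Gaussian elimination: after a row permutation the corner entry is nonzero, and the matrix
    factors into a shear of the first coordinate and a map that acts on the fibres by the Schur
    complement. *)
Lemma affmap_scales n (M : 'M[R]_n) (v : 'rV_n) : M \in unitmx ->
  scales_by `|\det M|^-1 (affmap M v).
Proof.
elim: n => [|n IHn] in M v *.
  move=> _; rewrite det_mx00 normr1 invr1 (_ : affmap M v = id).
    exact: scales_by_id.
  by apply/funext => t; apply: eq_from_tnth => -[].
move=> uM.
have [i Mi0] : exists i, M i ord0 != 0.
  apply/existsP; apply: contraLR uM => /existsPn M0.
  rewrite unitmxE (expand_det_col _ ord0) big1 ?unitr0// => i _.
  by have /negPn/eqP -> := M0 i; rewrite mul0r.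
have [s si hs] := scales_by_bring_to_front i.
rewrite (affmap_row_perm s).
have -> : `|\det M|^-1 = 1 * `|\det (row_perm s M)|^-1.
  by rewrite row_permE det_mulmx det_perm normrM normr_sign !mul1r.
apply: scales_by_comp => //.
have : row_perm s M \in unitmx by rewrite row_permE unitmx_mul unitmx_perm.
have : row_perm s M ord0 ord0 != 0 by rewrite mxE si.
move: (row_perm s M) v => {uM Mi0 hs si s i}M v.
rewrite -(@submxK R 1 n 1 n M) -(@hsubmxK R 1 1 n v).
rewrite [X in block_mx X]mx11_scalar [X in row_mx X]mx11_scalar.
move: (@ulsubmx _ 1 n 1 n M 0 0) (@ursubmx _ 1 n 1 n M) (@dlsubmx _ 1 n 1 n M)
  (@drsubmx _ 1 n 1 n M) (@lsubmx _ 1 1 n v 0 0) (@rsubmx _ 1 1 n v).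
move=> a u w W v0 {}v a0 uM.
have {}a0 : a != 0.
  have := block_mxEul (a%:M : 'M[R]_1) u w W ord0 ord0; rewrite [in RHS]mxE eqxx mulr1n => <-.
  by have -> : lshift n (ord0 : 'I_1) = (ord0 : 'I_n.+1) by exact/val_inj.
pose u' := a^-1 *: u.
pose W' := W - w *m u'.
(* Tuples are row vectors, so the left factor acts first: it is the shear, and the right factor
   preserves the first coordinate. *)
have ME : block_mx a%:M u w W = block_mx a%:M 0 w 1%:M *m block_mx 1%:M u' 0 W'.
  rewrite mulmx_block !mulmx0 !mul0mx !mulmx1 !addr0 mul1mx mul_scalar_mx.
  by rewrite scalerA divff// scale1r addrC subrK.
have dE : \det (block_mx a%:M u w W) = a * \det W'.
  rewrite ME det_mulmx det_lblock det_ublock !det1 det_scalar expr1; ring.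
have uW' : W' \in unitmx.
  by move: uM; rewrite !unitmxE dE !unitfE mulf_eq0 negb_or => /andP[].
rewrite dE normrM invfM.
pose phi (t : n.-tuple T) : T := (rowt t *m w) 0 0 + v0.
have mphi : measurable_fun setT phi.
  by apply: measurable_funD => //; exact: measurable_dot.
(* The shear already adds [v0] to the first coordinate; subtracting [v0 *: u'] cancels its effect on
   the tail. *)
pose g (y : R) := affmap W' (y *: u' + (v - v0 *: u')).
pose f := fun t : n.+1.-tuple T => cons_tuple (thead t) (g (thead t) (ttail t)).
have fE : f = affmap (block_mx 1%:M u' 0 W') (row_mx 0%:M (v - v0 *: u')).
  apply/funext => t; rewrite affmap_block mulmx0 mxE !addr0 mul1r /f /g /affmap.
  by congr (cons_tuple _ (tupr _)); rewrite addrCA addrA.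
rewrite (_ : affmap _ _ = f \o fun t => cons_tuple (a * thead t + phi (ttail t)) (ttail t)).
  apply: scales_by_comp; first exact: scales_by_shear.
  apply: scales_by_fiber => //; last by move=> x; exact: IHn.
  by rewrite -/f fE; exact: measurable_affmap.
apply/funext => t; rewrite affmap_block /f /= /g /affmap ttail_cons.
congr cons_tuple; congr tupr; set x := thead t; set r := rowt _.
rewrite /phi -/r theadE /W' mulmxBr /u' mulmxA.
have -> : r *m w *m (a^-1 *: u) = (r *m w) 0 0 *: (a^-1 *: u).
  by rewrite {1}[r *m w]mx11_scalar mul_scalar_mx.
move: (r *m W) ((r *m w) 0 0) => p q; apply/rowP => j; rewrite !mxE; field.
exact: a0.
Qed.

Lemma leb_tuple_affmap n (M : 'M[R]_n) (v : 'rV_n) A : M \in unitmx -> measurable A ->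
  leb_tuple R n (affmap M v @^-1` A) = (`|\det M|^-1%:E * leb_tuple R n A)%E.
Proof. by move=> uM; have [_] := affmap_scales v uM; exact. Qed.

Lemma measurable_halfspace n (w : 'cV[R]_n) c :
  measurable [set t : n.-tuple T | 0 <= (rowt t *m w) 0 0 + c].
Proof.
have := measurable_dot w measurableT (measurable_itv `[- c, +oo[).
rewrite setTI; congr measurable; apply/seteqP.
by split=> t /=; rewrite in_itv /= andbT -(subr_ge0 (- c)) opprK.
Qed.

Lemma measurable_hyperplane n (w : 'cV[R]_n) c :
  measurable [set t : n.-tuple T | (rowt t *m w) 0 0 = c].
Proof.
have := measurable_dot w measurableT (measurable_set1 (c : T)).
by rewrite setTI.
Qed.

Lemma rowt_cons_dot n x (t : n.-tuple R) (w : 'cV[R]_n.+1) :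
  (rowt (cons_tuple x t) *m w) 0 0 =
  x * w ord0 0 + (rowt t *m \col_j w (lift ord0 j) 0) 0 0.
Proof.
rewrite !mxE big_ord_recl /= !mxE tnth_cons0; congr (_ + _).
by apply: eq_bigr => j _; rewrite !mxE tnth_consS.
Qed.

(** If the tail of the normal vector is nonzero, every fibre over the first coordinate is a
    hyperplane of lower dimension. Otherwise every line in the first direction meets the set in one
    point. *)
Lemma leb_tuple_hyperplane n (w : 'cV[R]_n) c : w != 0 ->
  leb_tuple R n [set t | (rowt t *m w) 0 0 = c] = 0%E.
Proof.
elim: n => [|n IHn] in w c * => w0.
  by case/eqP: w0; apply/matrixP => -[].
have mH := measurable_hyperplane w c.
have [/eqP w'0|w'N0] := boolP ((\col_j w (lift ord0 j) 0) == 0 :> 'cV[R]_n).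
  have w00 : w ord0 0 != 0.
    apply: contraNneq w0 => w00; apply/eqP/matrixP => i j; rewrite !ord1 mxE.
    case: (unliftP ord0 i) => [k|] -> //.
    by have /matrixP/(_ k 0) := w'0; rewrite !mxE.
  rewrite leb_tupleS_tail// integral0_eq// => t _.
  rewrite (_ : [set x | _] = [set c / w ord0 0]) ?lebesgue_measure_set1//.
  apply/seteqP; split=> x /=; rewrite rowt_cons_dot w'0 mulmx0 mxE addr0.
    by move=> <-; rewrite mulfK.
  by move=> ->; rewrite divfK.
rewrite leb_tupleS integral0_eq// => x _.
rewrite -(IHn _ (c - x * w ord0 0) w'N0); congr (leb_tuple R n _).
apply/seteqP; split=> t /=; rewrite rowt_cons_dot.
  by move=> <-; rewrite addrAC subrr add0r.
by move=> ->; rewrite addrC subrK.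
Qed.

Definition box n (M : R) : set (n.-tuple T) := [set t | forall i, `|tnth t i| <= M].
Arguments box n M : clear implicits.

Lemma leb_tuple_box n (M : R) : 0 <= M ->
  measurable (box n M) /\ (leb_tuple R n (box n M) < +oo)%E.
Proof.
move=> M0; elim: n => [|n [mB Bfin]].
  have -> : box 0 M = setT by apply/seteqP; split=> // t _ [].
  by split; [exact: measurableT | rewrite -lebesgue_iterE /= diracE ltry].
have boxS : box n.+1 M = @uncons R n @^-1` (`[- M, M]%classic `*` box n M).
  apply/seteqP; split=> t /=.
    move=> h; split; first by rewrite /= in_itv /= -ler_norml; exact: h.
    by move=> i; have := h (lift ord0 i); rewrite -tnth_ttail.
  rewrite in_itv /= -ler_norml => -[h0 hS] i.
  by case: (unliftP ord0 i) => [j|] -> //; rewrite -tnth_ttail.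
have mBS : measurable (`[- M, M]%classic `*` box n M).
  by apply: measurableX => //; exact: measurable_itv.
rewrite boxS; split; first by rewrite -[X in measurable X]setTI; exact: measurable_uncons.
rewrite [X in (X < _)%E](_ : _ = (leb \x leb_tuple R n)%E (`[- M, M]%classic `*` box n M)).
  rewrite product_measure1E//= lte_mul_pinfty//.
  by rewrite lebesgue_measure_itv /=; case: ifP.
rewrite /= /cons_measure /pushforward -comp_preimage.
by rewrite (_ : _ \o _ = id) ?preimage_id //; apply/funext => p; rewrite /= cons_pairK.
Qed.

End LinearChangeOfVariables.

Arguments box {R} n M.

(** * Mixed subdivisions by linear programming *)

Section LinearProgramming.
Variables (R : realType) (n : nat) (J : finType) (a : J -> 'rV[R]_n) (w : J -> R).

Definition basis_mx (f : {ffun 'I_n -> J}) : 'M[R]_n := \matrix_i a (f i).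

(** The linear program writes [b] as a nonnegative combination of the [a j] at least total cost [w].
    Its dual maximizes [b *m y] subject to [a j *m y <= w j]; this is the [y] whose constraints are
    tight on the basis [f]. *)
Definition dual_price (f : {ffun 'I_n -> J}) : 'cV[R]_n :=
  invmx (basis_mx f) *m \col_i w (f i).

Definition dual_feasible (f : {ffun 'I_n -> J}) : bool :=
  (basis_mx f \in unitmx) && [forall j, (a j *m dual_price f) 0 0 <= w j].

(** Dual nondegeneracy: no vertex outside a basis has reduced cost zero. *)
Definition generic_cost : Prop := forall f, basis_mx f \in unitmx ->
  forall j, j \notin codom f -> (a j *m dual_price f) 0 0 != w j.

Definition basis_coord (f : {ffun 'I_n -> J}) (b : 'rV[R]_n) : 'rV[R]_n :=
  b *m invmx (basis_mx f).

Definition in_basis_cone f b := forall i, 0 <= basis_coord f b 0 i.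

Definition in_cone (b : 'rV[R]_n) : Prop :=
  exists2 c : J -> R, forall j, 0 <= c j & b = \sum_j c j *: a j.

Lemma basis_mxP f b : basis_mx f \in unitmx ->
  b = \sum_i basis_coord f b 0 i *: a (f i).
Proof.
move=> uf; rewrite -[LHS](mulmxKV uf) mulmx_sum_row.
by apply: eq_bigr => i _; rewrite rowK.
Qed.

Lemma basis_coord_unique f (c : 'rV[R]_n) : basis_mx f \in unitmx ->
  basis_coord f (\sum_i c 0 i *: a (f i)) = c.
Proof.
move=> uf; rewrite -[RHS](mulmxK uf) /basis_coord; congr (_ *m _); rewrite mulmx_sum_row.
by apply: eq_bigr => i _; rewrite rowK.
Qed.

Lemma dual_priceE f i : basis_mx f \in unitmx ->
  (a (f i) *m dual_price f) 0 0 = w (f i).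
Proof.
move=> uf; have := mulKVmx uf (\col_i w (f i)).
move=> /colP/(_ i); rewrite [RHS]mxE => <-.
by rewrite -/(dual_price f) !mxE; apply: eq_bigr => k _; rewrite !mxE.
Qed.

Lemma dual_price_unique f (y : 'cV[R]_n) : basis_mx f \in unitmx ->
  (forall i, (a (f i) *m y) 0 0 = w (f i)) -> dual_price f = y.
Proof.
move=> uf yE; rewrite -[RHS](mulKmx uf); congr (_ *m _); apply/colP => i.
by rewrite mxE -yE !mxE; apply: eq_bigr => k _; rewrite !mxE.
Qed.

Lemma dual_feasible_le f j : dual_feasible f -> (a j *m dual_price f) 0 0 <= w j.
Proof. by case/andP=> _ /forallP. Qed.

Lemma unitmx_row_inj (A : 'M[R]_n) :
  (forall u : 'rV[R]_n, u *m A = 0 -> u = 0) -> A \in unitmx.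
Proof.
move=> A0; rewrite -row_free_unit -kermx_eq0; apply/rowV0P => u /sub_kermxP.
exact: A0.
Qed.

Lemma mul_sum_dot (I : finType) (c : I -> R) (g : I -> 'rV[R]_n) (y : 'cV[R]_n) :
  ((\sum_i c i *: g i) *m y) 0 0 = \sum_i c i * (g i *m y) 0 0.
Proof.
rewrite mulmx_suml summxE; apply: eq_bigr => i _.
by rewrite -scalemxAl mxE.
Qed.

(* Dual simplex method: genericity of the cost excludes degenerate pivots, so a
   dual feasible basis with maximal objective is optimal. *)
Lemma dual_simplex b f0 : generic_cost -> dual_feasible f0 -> in_cone b ->
  exists2 f, dual_feasible f & in_basis_cone f b.
Proof.
move=> gen df0 [x x0 bE].
pose obj f := (b *m dual_price f) 0 0.
case: (@arg_maxP _ _ _ f0 dual_feasible obj df0) => f df fmax.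
have uf : basis_mx f \in unitmx by case/andP: df.
exists f => // r; rewrite leNgt; apply/negP => cr.
(* Moving the price along [- rho] relaxes the constraint of [f r], keeps those of the other basis
   vectors tight, and raises the objective because coordinate [r] of [b] is negative. *)
pose rho := col r (invmx (basis_mx f)).
have brho : (b *m rho) 0 0 = basis_coord f b 0 r.
  by rewrite /rho /basis_coord !mxE; apply: eq_bigr => k _; rewrite !mxE.
have arho i : (a (f i) *m rho) 0 0 = (i == r)%:R.
  have /matrixP/(_ i r) := mulmxV uf; rewrite [RHS]mxE => <-.
  by rewrite !mxE; apply: eq_bigr => k _; rewrite !mxE.
(* Otherwise [rho] would be nonnegative on all generators, hence on [b], contradicting [cr]. *)
have [j0 j0P] : exists j, (a j *m rho) 0 0 < 0.
  apply/existsP; apply: contraTT cr => /existsPn nn.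
  rewrite -leNgt -brho bE mul_sum_dot sumr_ge0// => j _.
  by rewrite mulr_ge0// leNgt nn.
(* Ratio test: the least ratio is the longest step for which all dual constraints survive. *)
pose ratio j := (w j - (a j *m dual_price f) 0 0) / - (a j *m rho) 0 0.
case: (@arg_minP _ _ _ j0 (fun j => (a j *m rho) 0 0 < 0) ratio j0P) => j jP jmin.
set theta := ratio j.
have jf : j \notin codom f.
  by apply/negP => /codomP[i ji]; move: jP; rewrite ji arho ltNge ler0n.
have theta_gt0 : 0 < theta.
  rewrite divr_gt0 ?oppr_gt0// subr_gt0 lt_neqAle (gen _ uf _ jf) /=.
  exact: dual_feasible_le.
pose f' := [ffun i => if i == r then j else f i].
pose y' := dual_price f - theta *: rho.
have y'E l : (a l *m y') 0 0 = (a l *m dual_price f) 0 0 - theta * (a l *m rho) 0 0.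
  by rewrite mulmxBr -scalemxAr !mxE.
have uf' : basis_mx f' \in unitmx.
  apply: unitmx_row_inj => u u0.
  have ur : u 0 r = 0.
    have : (u *m basis_mx f' *m rho) 0 0 = 0 by rewrite u0 mul0mx mxE.
    rewrite [u *m basis_mx f']mulmx_sum_row mul_sum_dot (bigD1 r)//= big1 => [|i ir].
      rewrite rowK ffunE eqxx addr0 => /eqP; rewrite mulf_eq0 (lt_eqF jP) orbF.
      exact: eqP.
    by rewrite rowK ffunE (negbTE ir) arho (negbTE ir) mulr0.
  have : u *m basis_mx f = 0.
    rewrite -u0 !mulmx_sum_row; apply: eq_bigr => i _; rewrite !rowK ffunE.
    by case: eqP => // ->; rewrite ur !scale0r.
  by move/(congr1 (mulmx^~ (invmx (basis_mx f)))); rewrite mulmxK// mul0mx.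
have f'y : dual_price f' = y'.
  apply: dual_price_unique => // i; rewrite y'E ffunE; case: eqP => [_|/eqP ir].
    rewrite /theta /ratio; field; by rewrite (lt_eqF jP).
  by rewrite arho (negbTE ir) mulr0 subr0 dual_priceE.
have df' : dual_feasible f'.
  rewrite /dual_feasible uf' /=; apply/forallP => l; rewrite f'y y'E.
  have ly := dual_feasible_le l df.
  have [l0|l0] := ltP ((a l *m rho) 0 0) 0.
    have := jmin _ l0; rewrite -/theta /ratio ler_pdivlMr ?oppr_gt0// mulrN.
    by rewrite lerBrDr addrC.
  by rewrite lerBlDr (le_trans ly)// lerDl mulr_ge0// ltW.
have : obj f' <= obj f := fmax _ df'.
have -> : obj f' = obj f - theta * basis_coord f b 0 r.
  by rewrite /obj f'y mulmxBr -scalemxAr -brho !mxE.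
by rewrite leNgt ltrDl oppr_gt0 nmulr_llt0// theta_gt0.
Qed.

(** Complementary slackness. By weak duality both prices give [b] the same value, so the sum of the
    products coordinate times slack vanishes; its terms are nonnegative, and genericity makes the
    slack of [f i] nonzero. *)
Lemma dual_feasible_overlap b f f' : generic_cost ->
  dual_feasible f -> dual_feasible f' -> in_basis_cone f b -> in_basis_cone f' b ->
  forall i, f i \notin codom f' -> basis_coord f b 0 i = 0.
Proof.
move=> gen.
have main g g' : dual_feasible g -> dual_feasible g' -> in_basis_cone g b ->
    in_basis_cone g' b -> (b *m dual_price g') 0 0 <= (b *m dual_price g) 0 0.
  move=> dg dg' bg bg'; have ug : basis_mx g \in unitmx by case/andP: dg.
  rewrite {1 2}(basis_mxP b ug) !mul_sum_dot; apply: ler_sum => i _.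
  by rewrite ler_wpM2l// dual_priceE// dual_feasible_le.
move=> df df' bf bf' i fi.
have [uf uf'] : basis_mx f \in unitmx /\ basis_mx f' \in unitmx.
  by case/andP: df; case/andP: df'.
have E : (b *m dual_price f') 0 0 = (b *m dual_price f) 0 0.
  by apply/eqP; rewrite eq_le !main.
pose g j := basis_coord f b 0 j * (w (f j) - (a (f j) *m dual_price f') 0 0).
have g0 j : 0 <= g j by rewrite mulr_ge0// subr_ge0 dual_feasible_le.
have : \sum_j g j = 0.
  move: E; rewrite {1 2}(basis_mxP b uf) !mul_sum_dot => /eqP.
  rewrite eq_sym -subr_eq0 -sumrB => /eqP E; rewrite -[RHS]E; apply: eq_bigr => j _.
  by rewrite /g dual_priceE// mulrBr.
move/eqP; rewrite psumr_eq0// => /allP/(_ i (mem_index_enum _)) /=.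
rewrite mulf_eq0 => /orP[/eqP //|].
by rewrite subr_eq0 eq_sym (negbTE (gen _ uf' _ fi)).
Qed.


End LinearProgramming.

(** * Existence of generic costs *)

Section GenericCost.
Variable R : realType.

Lemma poly_eventually_gt0 (p : {poly R}) : 0 < lead_coef p ->
  exists M, forall t, M <= t -> 0 < p.[t].
Proof.
(* The induction over [p * 'X + c] needs a uniform lower bound [e] in order to absorb [c]. *)
move=> p0; suff [M [e [M0 e0 h]]] : exists M e : R,
    [/\ 0 < M, 0 < e & forall t, M <= t -> e <= p.[t]].
  by exists M => t /h; exact: lt_le_trans.
elim/poly_ind: p p0 => [|p c IHp]; first by rewrite lead_coef0 ltxx.
have [->|p0] := eqVneq p 0.
  rewrite mul0r add0r lead_coefC => c0; exists 1, c; split=> // t _.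
  by rewrite hornerC.
rewrite lead_coefDl ?lead_coefMX; last first.
  by rewrite size_mulX// (leq_ltn_trans (size_polyC_leq1 c))// ltnS size_poly_gt0.
move=> /IHp[M [e [M0 e0 h]]].
(* Beyond [M] the inductive bound holds, and beyond [1 + |c| / e] the product [e * t] is at least
   [e + |c|]. *)
exists (M + (1 + `|c| / e)), e; split=> //.
  by rewrite addr_gt0// ltr_pwDl// divr_ge0// ltW.
move=> t tM; rewrite hornerMXaddC.
have t1 : 1 + `|c| / e <= t by rewrite (le_trans _ tM)// lerDr ltW.
have tM' : M <= t.
  by rewrite (le_trans _ tM)// lerDl addr_ge0// divr_ge0// ltW.
have t0 : 0 <= t by rewrite (le_trans _ tM')// ltW.
have et : e + `|c| <= e * t.
  by have := ler_wpM2l (ltW e0) t1; rewrite mulrDr mulr1 mulrCA divff ?gt_eqF// mulr1.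
have pt := ler_wpM2r t0 (h _ tM').
have := ler_norm (- c); rewrite normrN; lra.
Qed.

Lemma poly_eventually_neq0 (p : {poly R}) : p != 0 ->
  exists M, forall t, M <= t -> p.[t] != 0.
Proof.
move=> p0; have [lp|lp|/eqP] := ltgtP (lead_coef p) 0; last by rewrite lead_coef_eq0 (negbTE p0).
- have [|M hM] := @poly_eventually_gt0 (- p); first by rewrite lead_coefN oppr_gt0.
  by exists M => t /hM; rewrite hornerN oppr_gt0 => /lt_eqF ->.
- by have [M hM] := poly_eventually_gt0 lp; exists M => t /hM /gt_eqF ->.
Qed.

Lemma eventually_forall (I : finType) (P : I -> R -> Prop) :
  (forall i, exists M, forall t, M <= t -> P i t) ->
  exists M, forall t, M <= t -> forall i, P i t.
Proof.
move=> /boolp.choice[M hM]; exists (\sum_i `|M i|) => t tM i.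
apply: hM; rewrite (le_trans _ tM)// (le_trans (ler_norm _))// (bigD1 i)//=.
by rewrite lerDl sumr_ge0.
Qed.

Variables (n : nat) (J : finType) (a : J -> 'rV[R]_n).

(* The costs are powers [t ^ sigma j] of a large [t], the elements of the initial
   basis coming first in the ordering [sigma]. *)
Lemma generic_cost_exists f0 : basis_mx a f0 \in unitmx ->
  exists2 w, generic_cost a w & dual_feasible a w f0.
Proof.
move=> uf0.
pose sigma j := (if j \in codom f0 then enum_rank j : nat else #|J| + enum_rank j)%N.
have sigma_inj : injective sigma.
  move=> i j; rewrite /sigma.
  have ltJ l := ltn_ord (enum_rank l : 'I_#|J|).
  (case: ifP => _; case: ifP => _) => [/val_inj/enum_rank_inj //|E|E|].
  - by have := ltJ i; rewrite E ltnNge leq_addr.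
  - by have := ltJ j; rewrite -E ltnNge leq_addr.
  - by move=> /addnI/val_inj/enum_rank_inj.
have sigma_lt i j : j \notin codom f0 -> (sigma (f0 i) < sigma j)%N.
  move=> jf; rewrite /sigma codom_f (negbTE jf).
  by rewrite (leq_trans (ltn_ord _))// leq_addr.
pose comb f j : {poly R} := \sum_i basis_coord a f (a j) 0 i *: 'X^(sigma (f i)).
(* The reduced cost of [j] as a polynomial in [t]. For [j] outside [f] the exponent [sigma j] is
   absent from [comb f j], so [q f j] is nonzero; for [f0] this exponent is moreover the largest, so
   [q f0 j] is eventually positive. *)
pose q f j : {poly R} := 'X^(sigma j) - comb f j.
pose w t j : R := t ^+ sigma j.
have qE f j t : (q f j).[t] = w t j - (a j *m dual_price a (w t) f) 0 0.
  rewrite hornerD hornerN hornerXn; congr (_ - _).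
  rewrite /comb horner_sum /dual_price mulmxA mxE; apply: eq_bigr => i _.
  by rewrite hornerZ hornerXn; congr (_ * _); rewrite mxE.
have q_neq0 (f : {ffun 'I_n -> J}) j : j \notin codom f -> q f j != 0.
  move=> jf; apply/eqP => /(congr1 (fun p : {poly R} => p`_(sigma j))).
  rewrite coefB coefXn eqxx coef0 /comb coef_sum big1 ?subr0 => [/eqP|i _].
    by rewrite oner_eq0.
  rewrite coefZ coefXn; case: eqP => [/sigma_inj E|_]; last by rewrite mulr0.
  by move: jf; rewrite E codom_f.
have q_gt0 j : j \notin codom f0 -> 0 < lead_coef (q f0 j).
  move=> jf; rewrite lead_coefDl ?lead_coefXn// size_polyN size_polyXn ltnS.
  rewrite (leq_trans (size_sum _ _ _))//; apply/bigmax_leqP => i _.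
  by rewrite (leq_trans (size_scale_leq _ _))// size_polyXn sigma_lt.
have [|M1 hM1] := @eventually_forall ({ffun 'I_n -> J} * J)%type
    (fun x t => x.2 \notin codom x.1 -> (q x.1 x.2).[t] != 0).
  move=> [f j] /=; have [jf|jf] := boolP (j \in codom f); first by exists 0.
  by have [M hM] := poly_eventually_neq0 (q_neq0 _ _ jf); exists M => t /hM.
have [|M2 hM2] := @eventually_forall J
    (fun j t => j \notin codom f0 -> 0 < (q f0 j).[t]).
  move=> j /=; have [jf|jf] := boolP (j \in codom f0); first by exists 0.
  by have [M hM] := poly_eventually_gt0 (q_gt0 _ jf); exists M => t /hM.
pose t := Num.max M1 M2; exists (w t).
  have tM1 : M1 <= t by rewrite le_max lexx.
  by move=> f uf j jf; have := hM1 t tM1 (f, j) jf; rewrite qE subr_eq0 eq_sym.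
rewrite /dual_feasible uf0; apply/forallP => j.
have [/codomP[i ->]|jf] := boolP (j \in codom f0); first by rewrite dual_priceE.
by rewrite -subr_ge0 -qE ltW// hM2// le_max lexx orbT.
Qed.

End GenericCost.

(** * Additivity of a measure up to null overlaps *)

Section AlmostDisjointUnion.
Context d (X : measurableType d) (R : realType) (mu : {measure set X -> \bar R}).

Lemma measureU_null (A B : set X) : measurable A -> measurable B ->
  mu (A `&` B) = 0%E -> mu (A `|` B) = (mu A + mu B)%E.
Proof.
move=> mA mB AB0.
have -> : A `|` B = A `|` (B `\` A).
  apply/seteqP; split=> x [xA|xB]; try by left.
    by have [xA|xA] := pselect (A x); [left|right].
  by right; case: xB.
rewrite measureU//; last 2 first.
  exact: measurableD.
  by apply/seteqP; split=> // x [xA [_]].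
have -> : mu B = (mu (B `\` A) + mu (A `&` B))%E.
  by rewrite setIC; exact: measureDI.
by rewrite AB0 adde0.
Qed.

Lemma measure_bigsetU_null (I : eqType) (r : seq I) (C : I -> set X) : uniq r ->
  (forall i, measurable (C i)) ->
  {in r &, forall i j, i != j -> mu (C i `&` C j) = 0%E} ->
  mu (\big[setU/set0]_(i <- r) C i) = (\sum_(i <- r) mu (C i))%E.
Proof.
move=> + mC; elim: r => [|i r IHr] /=; first by rewrite !big_nil measure0.
move=> /andP[ir ur] disj; rewrite !big_cons.
have mU (s : seq I) : measurable (\big[setU/set0]_(j <- s) C j).
  by apply: bigsetU_measurable.
have disjr : {in r &, forall i j, i != j -> mu (C i `&` C j) = 0%E}.
  by move=> j j' jr j'r; apply: disj; rewrite in_cons ?jr ?j'r orbT.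
rewrite measureU_null//; first by rewrite IHr.
have : {in r, forall j, mu (C i `&` C j) = 0%E}.
  move=> j jr; apply: disj; rewrite ?in_cons ?eqxx ?jr ?orbT//.
  by apply: contraNneq ir => ->.
elim: {ir ur IHr disj disjr} r => [|j r IHr] h; first by rewrite big_nil setI0 measure0.
rewrite big_cons setIUr; apply/eqP; rewrite -measure_le0.
have mI A : measurable A -> measurable (C i `&` A) by exact: measurableI.
have : (mu ((C i `&` C j) `|` (C i `&` \big[setU/set0]_(j <- r) C j)) <=
    mu (C i `&` C j) + mu (C i `&` \big[setU/set0]_(j <- r) C j))%E.
  exact: (measureU2 mu (mI _ (mC j)) (mI _ (mU r))).
rewrite h ?mem_head// add0e IHr// => j' j'r; apply: h.
by rewrite in_cons j'r orbT.
Qed.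

End AlmostDisjointUnion.

(** * The Cayley embedding and coordinates on cells *)

Section CayleyTrick.
Variables (R : realType) (d k : nat) (J : finType) (p : J -> 'rV[R]_d) (l : J -> 'I_k).
Local Notation n := (d + k)%N.
Local Notation leb := (leb_tuple R d).

Implicit Types (x : 'rV[R]_d) (lam : 'rV[R]_k).

(** Each vertex is tagged with the unit vector of its polytope, so the last [k] coordinates of a
    combination record the total weight spent on each polytope. *)
Definition cayley_pt j : 'rV[R]_n := row_mx (p j) (delta_mx 0 (l j)).

Lemma cayley_sum (I : finType) (g : I -> J) (c : I -> R) :
  \sum_i c i *: cayley_pt (g i) =
  row_mx (\sum_i c i *: p (g i)) (\row_m \sum_(i | l (g i) == m) c i).
Proof.
rewrite -[LHS]hsubmxK; congr row_mx; apply/rowP => m; rewrite mxE !summxE.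
  by apply: eq_bigr => i _; rewrite mxE [RHS]mxE row_mxEl.
rewrite mxE [RHS]big_mkcond /=; apply: eq_bigr => i _.
rewrite mxE row_mxEr mxE eqxx /= eq_sym.
by case: eqP; rewrite ?mulr1 ?mulr0.
Qed.

(** For an invertible basis and nonnegative weights this is a sum of simplices, one per label,
    spanned by the basis vertices of that label and scaled by its weight. *)
Definition sum_cell (f : {ffun 'I_n -> J}) (lam : 'rV[R]_k) : set (d.-tuple R) :=
  [set t | in_basis_cone cayley_pt f (row_mx (rowt t) lam)].

(* The Minkowski sum of the [lam 0 i *: conv {p j | l j = i}], as the slice at
   height [lam] of the cone over the Cayley points. *)
Definition weighted_sum (lam : 'rV[R]_k) : set (d.-tuple R) :=
  [set t | in_cone cayley_pt (row_mx (rowt t) lam)].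

Definition label_mult (f : {ffun 'I_n -> J}) i := #|[set j | l (f j) == i]%SET|.

Local Notation coord f x lam := (basis_coord cayley_pt f (row_mx x lam)).
Local Notation B f := (basis_mx cayley_pt f).

Lemma coord_split f x lam i :
  coord f x lam 0 i = (x *m col i (usubmx (invmx (B f)))) 0 0 +
                      (lam *m col i (dsubmx (invmx (B f)))) 0 0.
Proof.
rewrite /basis_coord -{1}(vsubmxK (invmx (B f))) mul_row_col mxE.
by congr (_ + _); rewrite !mxE; apply: eq_bigr => m _; rewrite !mxE.
Qed.

Lemma coord_label_sum f x lam (i : 'I_k) : B f \in unitmx ->
  lam 0 i = \sum_(j | l (f j) == i) coord f x lam 0 j.
Proof.
move=> uf; have := basis_mxP (row_mx x lam) uf; rewrite cayley_sum.
by move=> /eq_row_mx[_ /rowP/(_ i)]; rewrite mxE.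
Qed.

(** At the height [delta_mx 0 i] the coordinates of label [i] sum to 1, so there is at least one. *)
Lemma label_mult_gt0 f i : B f \in unitmx -> (0 < label_mult f i)%N.
Proof.
move=> uf; rewrite lt0n /label_mult cards_eq0; apply/negP => /eqP E.
have := coord_label_sum 0 (delta_mx 0 i) i uf; rewrite big_pred0 => [|j].
  by rewrite !mxE !eqxx => /eqP; rewrite oner_eq0.
by have /setP/(_ j) := E; rewrite !inE.
Qed.

Lemma sum_label_mult f : (\sum_i label_mult f i)%N = n.
Proof.
under eq_bigr do rewrite /label_mult -sum1_card.
rewrite -[RHS]card_ord -sum1_card (partition_big (fun j => l (f j)) xpredT)//=.
by apply: eq_bigr => i _; apply: eq_bigl => j; rewrite !inE.
Qed.

Lemma label_mult1_unique f j j' : label_mult f (l (f j)) = 1%N ->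
  l (f j') = l (f j) -> j' = j.
Proof.
move=> /eqP/cards1P[m mE] jj'.
have : j' \in [set m]%SET by rewrite -mE inE jj'.
have : j \in [set m]%SET by rewrite -mE inE.
by rewrite !inE => /eqP -> /eqP.
Qed.

Lemma label_mult1_coord f x lam j : B f \in unitmx ->
  label_mult f (l (f j)) = 1%N -> coord f x lam 0 j = lam 0 (l (f j)).
Proof.
move=> uf m1; rewrite (coord_label_sum x lam _ uf) (big_pred1 j)// => j' /=.
by apply/eqP/eqP => [|-> //]; exact: label_mult1_unique.
Qed.

Lemma coord_cayley f j : B f \in unitmx ->
  basis_coord cayley_pt f (cayley_pt (f j)) = delta_mx 0 j.
Proof.
move=> uf; rewrite -[RHS](basis_coord_unique _ uf) (bigD1 j)//= big1 => [|i ij].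
  by rewrite !mxE !eqxx scale1r addr0.
by rewrite mxE (negbTE ij) andbF scale0r.
Qed.

(** Two basis vertices with the same label differ only in position, yet coordinate [j] is 1 at one
    and 0 at the other. *)
Lemma coord_nonconstant f j : B f \in unitmx -> (1 < label_mult f (l (f j)))%N ->
  col j (usubmx (invmx (B f))) != 0.
Proof.
move=> uf /card_gt1P[j1 [j2 []]]; rewrite !inE => /eqP l1 /eqP l2 j12.
have [j' l' jj'] : exists2 j', l (f j') = l (f j) & j' != j.
  by have [E|] := eqVneq j1 j; [exists j2; rewrite // -E eq_sym | exists j1].
apply/eqP => c0.
have := coord_cayley j uf => /rowP/(_ j); have := coord_cayley j' uf => /rowP/(_ j).
rewrite !coord_split c0 !mulmx0 l' => -> /eqP.
by rewrite !mxE !eqxx /= (eq_sym j j') (negbTE jj') /= ?oner_eq0 // eq_sym oner_eq0.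
Qed.

Lemma coord_measurable f lam j :
  measurable [set t : d.-tuple (measurableTypeR R) | 0 <= coord f (rowt t) lam 0 j].
Proof.
rewrite [X in measurable X](_ : _ = [set t | 0 <=
    (rowt t *m col j (usubmx (invmx (B f)))) 0 0 +
    (lam *m col j (dsubmx (invmx (B f)))) 0 0]); first exact: measurable_halfspace.
by apply/seteqP; split=> t /=; rewrite coord_split.
Qed.

Lemma measurable_sum_cell f lam :
  measurable (sum_cell f lam : set (d.-tuple (measurableTypeR R))).
Proof.
rewrite (_ : sum_cell f lam = \bigcap_(j in [set: 'I_n])
    [set t | 0 <= coord f (rowt t) lam 0 j]); last first.
  by apply/seteqP; split=> t /= h j; [move=> _|]; exact: h.
by apply: fin_bigcap_measurable => // j _; exact: coord_measurable.
Qed.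

Lemma null_subset (A C : set (d.-tuple R)) : A `<=` C -> leb C = 0%E -> leb A = 0%E.
Proof.
rewrite -!lebesgue_iterE => AC C0; apply/eqP; rewrite eq_le lebesgue_iter_ge0 andbT.
by rewrite -C0; exact: lebesgue_iter_mono.
Qed.

Lemma null_coord f lam j (A : set (d.-tuple R)) : B f \in unitmx ->
  (1 < label_mult f (l (f j)))%N ->
  (forall t, A t -> coord f (rowt t) lam 0 j = 0) -> leb A = 0%E.
Proof.
move=> uf mj A0; have c0 := coord_nonconstant uf mj.
have := leb_tuple_hyperplane (- (lam *m col j (dsubmx (invmx (B f)))) 0 0) c0.
apply: null_subset => t /A0; rewrite coord_split => /eqP.
by rewrite addr_eq0 => /eqP.
Qed.

End CayleyTrick.

(** * Volume of one cell as a monomial in the weights *)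

Section MixedCells.
Variables (R : realType) (d k : nat) (J : finType) (p : J -> 'rV[R]_d) (l : J -> 'I_k).
Local Notation n := (d + k)%N.
Local Notation leb := (leb_tuple R d).
Local Notation a := (cayley_pt p l).
Local Notation B f := (basis_mx a f).
Local Notation coord f x lam := (basis_coord a f (row_mx x lam)).
Implicit Types (f : {ffun 'I_n -> J}) (x : 'rV[R]_d) (lam : 'rV[R]_k).

(** A simplex has one dimension less than it has vertices, whence the predecessor in the
    exponent. *)
Definition cell_weight f lam : R := \prod_i lam 0 i ^+ (label_mult l f i).-1.

(** The nonnegative coordinates of label [i] sum to 0, so all vanish; with at least two of them,
    this confines the cell to a hyperplane. *)
Lemma cell_volume_degenerate f lam i : B f \in unitmx ->
  (1 < label_mult l f i)%N -> lam 0 i = 0 -> leb (sum_cell p l f lam) = 0%E.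
Proof.
move=> uf mi li0; have /card_gt0P[j] : (0 < label_mult l f i)%N by exact: ltnW.
rewrite inE => /eqP lj; rewrite -lj in mi li0.
apply: (null_coord (lam := lam) uf mi) => t ft.
have := coord_label_sum (rowt t) lam (l (f j)) uf; rewrite li0 => /esym/eqP.
by rewrite psumr_eq0 => [/allP/(_ j (mem_index_enum _))|m _]; [rewrite eqxx => /eqP | exact: ft].
Qed.

(* Rescaling the coordinates in the basis [B f] maps the cell of weight 1 to the
   cell of weight [lam]; in the standard basis this is block triangular, which
   gives the determinant. The coordinate of a vertex alone with its label is fixed
   by the weight, so it is translated instead, which also allows weight 0. *)
Lemma cell_volume f lam : B f \in unitmx -> (forall i, 0 <= lam 0 i) ->
  leb (sum_cell p l f lam) =
  ((cell_weight f lam)%:E * leb (sum_cell p l f (const_mx 1%R)))%E.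
Proof.
move=> uf lam0.
have [/existsP[i /andP[mi /eqP li0]]|/existsPn nz] :=
    boolP [exists i, (1 < label_mult l f i)%N && (lam 0 i == 0)].
  rewrite (cell_volume_degenerate uf mi li0) /cell_weight (bigD1 i)//= li0.
  by rewrite expr0n -subn1 subn_eq0 leqNgt mi /= mul0r mul0e.
have m_gt0 i : (0 < label_mult l f i)%N by exact: (label_mult_gt0 i uf).
pose delta i := if label_mult l f i == 1%N then 1 else lam 0 i.
have delta_gt0 i : 0 < delta i.
  rewrite /delta; case: eqP => // /eqP m1; rewrite lt_neqAle lam0 andbT eq_sym.
  by have := nz i; rewrite negb_and -leqNgt leq_eqVlt (negbTE m1) ltnNge m_gt0.
pose D : 'M[R]_n := diag_mx (\row_j delta (l (f j))).
pose sg : 'rV[R]_n :=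
  \row_j if label_mult l f (l (f j)) == 1%N then lam 0 (l (f j)) - 1 else 0.
pose Nn : 'M[R]_n := invmx (B f) *m D *m B f.
have NnE b : b *m Nn = basis_coord a f b *m D *m B f by rewrite /Nn !mulmxA.
have labelB (c : 'rV[R]_n) i : rsubmx (c *m B f) 0 i = \sum_(j | l (f j) == i) c 0 j.
  have -> : c *m B f = \sum_j c 0 j *: a (f j).
    by rewrite mulmx_sum_row; apply: eq_bigr => j _; rewrite rowK.
  by rewrite cayley_sum row_mxKr mxE.
have DE (c : 'rV[R]_n) j : (c *m D) 0 j = c 0 j * delta (l (f j)).
  by rewrite mul_mx_diag !mxE.
have rN x nu : rsubmx (row_mx x nu *m Nn) = nu *m diag_mx (\row_i delta i).
  apply/rowP => i; rewrite NnE labelB mul_mx_diag !mxE (coord_label_sum x nu i uf).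
  by rewrite mulr_suml; apply: eq_bigr => j /eqP <-; rewrite DE.
pose M := ulsubmx Nn.
have urN : ursubmx Nn = 0.
  apply/row_matrixP => i; have := rN (delta_mx 0 i) 0.
  rewrite -{1}(submxK Nn) mul_row_block row_mxKr mul0mx addr0 mul0mx row0 => <-.
  by rewrite rowE.
have drN : drsubmx Nn = diag_mx (\row_i delta i).
  apply/row_matrixP => i; have := rN 0 (delta_mx 0 i).
  rewrite -{1}(submxK Nn) mul_row_block row_mxKr mul0mx add0r !rowE.
  by move=> ->.
(* [Nn] is conjugate to [D], which has one factor [delta i] per basis vertex of label [i]; the lower
   right block takes one of them away. For multiplicity 1 the exponent left is 0, so [delta i] and
   the weight agree. *)
have detM : \det M = cell_weight f lam.
  have detN : \det Nn = \det M * \prod_i delta i.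
    rewrite -(submxK Nn) urN det_lblock drN det_diag; congr (_ * _).
    by apply: eq_bigr => i _; rewrite mxE.
  have : \det Nn = \prod_i delta i ^+ label_mult l f i.
    rewrite /Nn !det_mulmx mulrAC -det_mulmx mulVmx// det1 mul1r det_diag.
    rewrite (partition_big (fun j => l (f j)) xpredT)//=; apply: eq_bigr => i _.
    rewrite /label_mult -prodr_const; apply: eq_big => [j|j /eqP <-]; last by rewrite mxE.
    by rewrite inE.
  have -> : \prod_i delta i ^+ label_mult l f i = cell_weight f lam * \prod_i delta i.
    rewrite -big_split /=; apply: eq_bigr => i _.
    rewrite -[label_mult l f i in LHS]prednK// exprSr; congr (_ * _).
    by rewrite /delta; case: eqP => [->|//]; rewrite !expr0.
  rewrite detN => /mulIf; apply; rewrite prodf_seq_neq0.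
  by apply/allP => i _ /=; rewrite gt_eqF.
have w_gt0 : 0 < cell_weight f lam.
  rewrite prodr_gt0// => i _; have := delta_gt0 i; rewrite /delta.
  by case: eqP => [->|_ /exprn_gt0 //]; rewrite expr0.
pose v := const_mx 1 *m dlsubmx Nn + lsubmx (sg *m B f).
(* [Nn] already sends height 1 to [lam 0 i] for repeated labels and leaves it at 1 for the others;
   there [sg] adds the missing [lam 0 i - 1]. *)
have key x : row_mx (x *m M + v) lam = row_mx x (const_mx 1) *m Nn + sg *m B f.
  rewrite -[RHS]hsubmxK; congr row_mx.
    by rewrite -{1}(submxK Nn) mul_row_block -[sg *m B f]hsubmxK add_row_mx !row_mxKl /v addrA.
  rewrite linearD /= rN; apply/rowP => i; rewrite mxE labelB mul_mx_diag !mxE mul1r.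
  have [m1|m1] := eqVneq (label_mult l f i) 1%N.
    have /card_gt0P[j] := m_gt0 i; rewrite inE => /eqP lj.
    rewrite (big_pred1 j) => [|j']; last first.
      rewrite -lj in m1 *; apply/eqP/eqP => [|-> //].
      exact: label_mult1_unique.
    by rewrite mxE lj m1 /delta m1 eqxx addrC subrK.
  rewrite big1 ?addr0 => [|j /eqP lj]; first by rewrite /delta (negbTE m1).
  by rewrite mxE lj (negbTE m1).
have pre : affmap M v @^-1` sum_cell p l f lam = sum_cell p l f (const_mx 1).
  have cE x j : coord f (x *m M + v) lam 0 j =
      coord f x (const_mx 1) 0 j * delta (l (f j)) + sg 0 j.
    rewrite key /basis_coord mulmxDl mulmxK// NnE mulmxK// mxE DE //.
  apply/seteqP; split=> t /= ft j; have := ft j; rewrite /affmap ?tuprK cE [sg 0 j]mxE /delta;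
    case: eqP => m1; rewrite ?mulr1 ?addr0.
  - by rewrite (label_mult1_coord _ _ uf m1) mxE.
  - by rewrite pmulr_lge0//; have := delta_gt0 (l (f j)); rewrite /delta; case: eqP.
  - by rewrite (label_mult1_coord _ _ uf m1) mxE addrC subrK.
  - by rewrite pmulr_lge0//; have := delta_gt0 (l (f j)); rewrite /delta; case: eqP.
have uM : M \in unitmx by rewrite unitmxE detM unitfE gt_eqF.
rewrite -pre leb_tuple_affmap//; last exact: measurable_sum_cell.
by rewrite detM gtr0_norm// muleA -EFinM mulfV ?gt_eqF// mul1e.
Qed.

End MixedCells.

(** * Volume of a weighted sum as a homogeneous polynomial *)

Section MinkowskiPolynomial.
Variables (R : realType) (d k : nat) (J : finType) (p : J -> 'rV[R]_d) (l : J -> 'I_k).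
Local Notation n := (d + k)%N.
Local Notation leb := (leb_tuple R d).
Local Notation a := (cayley_pt p l).
Local Notation B f := (basis_mx a f).
Local Notation coord f x lam := (basis_coord a f (row_mx x lam)).
Implicit Types (f : {ffun 'I_n -> J}) (x : 'rV[R]_d) (lam : 'rV[R]_k).

Lemma cayley_pt_dot j (y : 'cV[R]_n) :
  (a j *m y) 0 0 = (p j *m usubmx y) 0 0 + dsubmx y (l j) 0.
Proof.
rewrite -{1}(vsubmxK y) mul_row_col mxE; congr (_ + _).
by rewrite -rowE mxE.
Qed.

(* Two distinct bases exchanging only vertices that are alone with their label
   would have the same slope [z = 0], and genericity would order the exchanged
   vertices strictly in both directions. *)
Lemma exchange_nonunique (w : J -> R) f f' j : generic_cost a w ->
  dual_feasible a w f -> dual_feasible a w f' -> f j \notin codom f' ->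
  (forall i, f i \notin codom f' -> label_mult l f (l (f i)) = 1%N) ->
  (forall i, f' i \notin codom f -> label_mult l f' (l (f' i)) = 1%N) -> False.
Proof.
move=> gen df df' jf' mf mf'.
have [uf uf'] : B f \in unitmx /\ B f' \in unitmx by case/andP: df; case/andP: df'.
pose z := dual_price a w f - dual_price a w f'.
have /boolp.choice[pk pkP] : forall i, exists j, l (f j) = i.
  by move=> i; have /card_gt0P[m] := label_mult_gt0 i uf; rewrite inE => /eqP; exists m.
(* Let [h] give each label the height that cancels its chosen vertex. Then every vertex of [f] is
   cancelled: shared vertices have both prices tight, and exchanged ones are alone with their label.
   Invertibility of [B f] makes the slope vanish. *)
have zx : usubmx z = 0.
  pose h : 'cV[R]_k := \col_i - (p (f (pk i)) *m usubmx z) 0 0.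
  have common m : f m \in codom f' -> (p (f m) *m usubmx z) 0 0 = - dsubmx z (l (f m)) 0.
    move=> /codomP[m' mm']; apply/eqP; rewrite -addr_eq0 -cayley_pt_dot mulmxBr.
    by rewrite [X in X == 0]mxE [X in _ + X]mxE dual_priceE// mm' dual_priceE// subrr.
  have Bzh : B f *m col_mx (usubmx z) h = 0.
    apply/colP => m; rewrite [RHS]mxE.
    have -> : (B f *m col_mx (usubmx z) h) m 0 = (a (f m) *m col_mx (usubmx z) h) 0 0.
      by rewrite !mxE; apply: eq_bigr => i _; rewrite !mxE.
    rewrite cayley_pt_dot col_mxKu col_mxKd [X in _ + X]mxE; apply/eqP; rewrite subr_eq0; apply/eqP.
    have [mc|mc] := boolP (f m \in codom f').
      have [mc'|mc'] := boolP (f (pk (l (f m))) \in codom f').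
        by rewrite !common// pkP.
      have := label_mult1_unique (mf _ mc'); rewrite pkP => /(_ m erefl) E.
      by rewrite -E.
    by rewrite (label_mult1_unique (mf _ mc) (pkP _)).
  have := congr1 (mulmx (invmx (B f))) Bzh; rewrite mulKmx// mulmx0.
  by rewrite -col_mx0 => /eq_col_mx[].
have [j' lj'] : exists j', l (f' j') = l (f j).
  have /card_gt0P[m] := label_mult_gt0 (l (f j)) uf'.
  by rewrite inE => /eqP; exists m.
have j'f : f' j' \notin codom f.
  apply/negP => /codomP[m mE]; move: lj'; rewrite mE => /(label_mult1_unique (mf _ jf')) mj.
  by move/negP: jf'; apply; rewrite -mj -mE codom_f.
have lt1 : (a (f' j') *m dual_price a w f) 0 0 < w (f' j').
  by rewrite lt_neqAle gen//= dual_feasible_le.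
have lt2 : (a (f j) *m dual_price a w f') 0 0 < w (f j).
  by rewrite lt_neqAle gen//= dual_feasible_le.
move: lt1 lt2 (dual_priceE w j uf) (dual_priceE w j' uf'); rewrite !cayley_pt_dot lj'.
have -> : usubmx (dual_price a w f) = usubmx (dual_price a w f').
  by apply/eqP; rewrite -subr_eq0 -linearB /= -/z zx.
lra.
Qed.

(** An exchanged vertex that is not alone with its label has a nonconstant coordinate that vanishes
    on the overlap. If no such vertex exists, [exchange_nonunique] leaves only orderings of the same
    basis. *)
Lemma overlap_null (w : J -> R) f f' lam : generic_cost a w ->
  dual_feasible a w f -> dual_feasible a w f' -> codom f =i codom f' \/
  leb (sum_cell p l f lam `&` sum_cell p l f' lam) = 0%E.
Proof.
move=> gen df df'.
have main g g' : dual_feasible a w g -> dual_feasible a w g' ->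
    forall j, g j \notin codom g' -> label_mult l g (l (g j)) != 1%N ->
    leb (sum_cell p l g lam `&` sum_cell p l g' lam) = 0%E.
  move=> dg dg' j jg' mj; have ug : B g \in unitmx by case/andP: dg.
  apply: (null_coord (lam := lam) (j := j) ug).
    by rewrite ltn_neqAle eq_sym mj (label_mult_gt0 _ ug).
  by move=> t [tg tg']; apply: (dual_feasible_overlap gen dg dg').
have [/existsP[j /andP[jf' mj]]|/existsPn h1] :=
    boolP [exists j, (f j \notin codom f') && (label_mult l f (l (f j)) != 1%N)].
  by right; exact: (main f f' df df' j).
have [/existsP[j /andP[jf' mj]]|/existsPn h2] :=
    boolP [exists j, (f' j \notin codom f) && (label_mult l f' (l (f' j)) != 1%N)].
  by right; rewrite setIC; exact: (main f' f df' df j).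
have {}h1 j : f j \notin codom f' -> label_mult l f (l (f j)) = 1%N.
  by move=> jf'; have := h1 j; rewrite jf' /= negbK => /eqP.
have {}h2 j : f' j \notin codom f -> label_mult l f' (l (f' j)) = 1%N.
  by move=> jf'; have := h2 j; rewrite jf' /= negbK => /eqP.
left => x; apply/codomP/codomP => -[j ->].
  have [/codomP //|jf'] := boolP (f j \in codom f').
  by have := exchange_nonunique gen df df' jf' h1 h2.
have [/codomP //|jf'] := boolP (f' j \in codom f).
by have := exchange_nonunique gen df' df jf' h2 h1.
Qed.

Lemma cell_coord_le1 f t j : B f \in unitmx -> sum_cell p l f (const_mx 1) t ->
  coord f (rowt t) (const_mx 1) 0 j <= 1.
Proof.
move=> uf ft; have := coord_label_sum (rowt t) (const_mx 1) (l (f j)) uf.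
rewrite mxE => E; rewrite [leRHS]E (bigD1 j)//= lerDl sumr_ge0// => i _; exact: ft.
Qed.

(** At weight 1 the coordinates lie between 0 and 1. Finiteness lets [fine] be undone in the
    polynomial. *)
Lemma cell_bounded f : B f \in unitmx ->
  (leb (sum_cell p l f (const_mx 1%R)) < +oo)%E.
Proof.
move=> uf; pose M : R := \sum_j \sum_m `|p (f j) 0 m|.
have M0 : 0 <= M by rewrite sumr_ge0// => j _; rewrite sumr_ge0.
have [_] := leb_tuple_box d M0; apply: le_lt_trans.
rewrite -!lebesgue_iterE; apply: lebesgue_iter_mono => t ft m.
have := basis_mxP (row_mx (rowt t) (const_mx 1)) uf; rewrite cayley_sum.
move=> /eq_row_mx[/rowP/(_ m) + _]; rewrite mxE => ->; rewrite summxE.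
rewrite (le_trans (ler_norm_sum _ _ _))// ler_sum// => j _.
rewrite (bigD1 m)//= mxE normrM ler_wpDr// ?sumr_ge0//.
rewrite ler_piMl// ger0_norm; [exact: cell_coord_le1 | exact: ft].
Qed.

Lemma weighted_sum_label lam t : weighted_sum p l lam t ->
  exists2 c : J -> R, forall j, 0 <= c j & rowt t = \sum_j c j *: p j /\
    forall i, lam 0 i = \sum_(j | l j == i) c j.
Proof.
move=> [c c0 E]; exists c => //; move: E; rewrite (cayley_sum p l id c).
by move=> /eq_row_mx[-> ->]; split=> // i; rewrite mxE.
Qed.

(** All Cayley points are annihilated by some nonzero [z]. Its position part is nonzero since every
    label occurs, so each slice lies in a hyperplane. *)
Lemma no_basis_null lam : (forall i, exists j, l j = i) ->
  (forall f, B f \notin unitmx) -> leb (weighted_sum p l lam) = 0%E.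
Proof.
move=> lsurj nobasis; pose A : 'M[R]_(#|J|, n) := \matrix_i a (enum_val i).
have Anf : ~~ row_full A.
  apply/negP => fA; have := nobasis [ffun i => enum_val (fullrankfun fA i)].
  rewrite (_ : B _ = rowsub (fullrankfun fA) A) ?fullrowsub_unit//.
  by apply/matrixP => i j; rewrite !mxE ffunE.
have [z z0 Az] : exists2 z : 'cV[R]_n, z != 0 & A *m z = 0.
  have : kermx A^T != 0 by rewrite kermx_eq0 /row_free mxrank_tr.
  move=> /rowV0Pn[u /sub_kermxP uA u0]; exists u^T; first by rewrite trmx_eq0.
  by rewrite -[A]trmxK -trmx_mul uA trmx0.
have az j : (a j *m z) 0 0 = 0.
  have /colP/(_ (enum_rank j)) := Az; rewrite [RHS]mxE => <-.
  by rewrite !mxE; apply: eq_bigr => i _; rewrite !mxE enum_rankK.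
have zx : usubmx z != 0.
  apply: contra_neq z0 => zx; rewrite -(vsubmxK z) zx; apply/eqP.
  rewrite col_mx_eq0 eqxx /=; apply/eqP/colP => i; rewrite [RHS]mxE.
  by have [j <-] := lsurj i; have := az j; rewrite cayley_pt_dot zx mulmx0 mxE add0r.
have := leb_tuple_hyperplane (- (lam *m dsubmx z) 0 0) zx.
apply: null_subset => t [c c0 E]; apply/eqP; rewrite -addr_eq0.
have := congr1 (mulmx^~ z) E; rewrite -{1}(vsubmxK z) mul_row_col => /matrixP/(_ 0 0).
rewrite mxE => ->; rewrite mul_sum_dot big1// => j _.
by rewrite az mulr0.
Qed.

Lemma in_basis_cone_codom f f' b : B f \in unitmx -> B f' \in unitmx ->
  codom f =i codom f' -> in_basis_cone a f b -> in_basis_cone a f' b.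
Proof.
move=> uf uf' ff' bf i; rewrite (basis_mxP b uf) /basis_coord mulmx_suml summxE.
rewrite sumr_ge0// => m _; rewrite -scalemxAl mxE; apply: mulr_ge0; first exact: (bf m).
have /codomP[m' ->] : f m \in codom f' by rewrite -ff' codom_f.
have := coord_cayley m' uf'; rewrite /basis_coord => ->.
by rewrite mxE ler0n.
Qed.

Lemma in_basis_cone_sub f b : B f \in unitmx -> in_basis_cone a f b -> in_cone a b.
Proof.
move=> uf bf; exists (fun j => \sum_(i | f i == j) basis_coord a f b 0 i).
  by move=> j; rewrite sumr_ge0.
rewrite [LHS](basis_mxP b uf) (partition_big f xpredT)//=; apply: eq_bigr => j _.
by rewrite scaler_suml; apply: eq_bigr => i /eqP ->.
Qed.

(** Coefficients and exponents are fixed before the weights. The degree is claimed only for nonzero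
    coefficients because sets that are not the vertex set of a dual feasible basis receive the
    exponents 0. *)
Theorem minkowski_polynomial : (forall i, exists j, l j = i) ->
  exists (v : {set J} -> R) (e : {set J} -> 'I_k -> nat),
    (forall S, v S != 0 -> (\sum_i e S i)%N = d) /\
    forall lam, (forall i, 0 <= lam 0 i) ->
      lebesgue_iter (weighted_sum p l lam) = (\sum_S v S * \prod_i lam 0 i ^+ e S i)%:E.
Proof.
move=> lsurj; have [/existsP[f0 uf0]|/existsPn nobasis] := boolP [exists f, B f \in unitmx];
  last first.
  exists (fun=> 0), (fun _ _ => 0%N); split=> [S|lam _]; first by rewrite eqxx.
  by rewrite lebesgue_iterE no_basis_null// big1// => S _; rewrite mul0r.
have [w gen df0] := generic_cost_exists uf0.
(* Bases are ordered, and all orderings of one basis describe the same cell; one representative per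
   vertex set avoids counting it repeatedly. *)
pose rep S := [pick f | dual_feasible a w f && ([set x in codom f]%SET == S)].
have repP S f : rep S = Some f -> dual_feasible a w f /\ [set x in codom f]%SET = S.
  by rewrite /rep; case: pickP => // f' /andP[df' /eqP] + [<-].
have unitP S f : rep S = Some f -> B f \in unitmx by case/repP => /andP[].
exists (fun S => if rep S is Some f then fine (leb (sum_cell p l f (const_mx 1))) else 0).
exists (fun S i => if rep S is Some f then (label_mult l f i).-1 else 0%N).
split=> [S|lam lam0].
  case E: (rep S) => [f|]; last by rewrite eqxx.
  have uf := unitP _ _ E => _; apply/eqP; rewrite -(eqn_add2r k) -(sum_label_mult l f).
  rewrite -[X in (_ + X)%N]card_ord -sum1_card -big_split /=; apply/eqP.
  by apply: eq_bigr => i _; rewrite addn1 prednK// (label_mult_gt0 i uf).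
pose C S : set (d.-tuple (measurableTypeR R)) :=
  if rep S is Some f then sum_cell p l f lam else set0.
have mC S : measurable (C S).
  by rewrite /C; case: (rep S) => [f|]; [exact: measurable_sum_cell | exact: measurable0].
have -> : weighted_sum p l lam = \big[setU/set0]_S C S.
  apply/seteqP; split=> t.
    move=> tw; have [f df tf] := dual_simplex gen df0 tw.
    rewrite -bigcup_seq.
    exists [set x in codom f]%SET; first by rewrite /= mem_index_enum.
    rewrite /C; case E: (rep _) => [f'|]; last first.
      by move: E; rewrite /rep; case: pickP => // /(_ f); rewrite df eqxx.
    have [df' /setP ff'] := repP _ _ E; apply: (in_basis_cone_codom _ _ _ tf).
    - by case/andP: df.
    - by case/andP: df'.
    - by move=> x; have := ff' x; rewrite !inE.
  rewrite -bigcup_seq => -[S _]; rewrite /C; case E: (rep S) => [f|//].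
  exact: in_basis_cone_sub (unitP _ _ E).
rewrite lebesgue_iterE measure_bigsetU_null//; last 2 first.
- exact: index_enum_uniq.
- move=> S S' _ _ SS'; rewrite /C; case E: (rep S) => [f|]; last by rewrite set0I measure0.
  case E': (rep S') => [f'|]; last by rewrite setI0 measure0.
  have [df fS] := repP _ _ E; have [df' fS'] := repP _ _ E'.
  have [ff'|//] := overlap_null lam gen df df'.
  by case/eqP: SS'; rewrite -fS -fS'; apply/setP => x; rewrite !inE.
rewrite -sumEFin; apply: eq_bigr => S _; rewrite /C.
case E: (rep S) => [f|]; last by rewrite mul0r measure0.
have uf := unitP _ _ E.
rewrite [LHS](cell_volume uf lam0) muleC EFinM fineK//.
by rewrite ge0_fin_numE ?cell_bounded.
Qed.

End MinkowskiPolynomial.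

(** * Mixed volumes *)

Section Polarization.
Variables (R : realFieldType) (d : nat).

Definition subset_sign (S : {ffun 'I_d -> bool}) : R := \prod_i (-1) ^+ (~~ S i).

Lemma sum_subset_sign (h : 'I_d -> bool -> R) :
  \sum_S subset_sign S * \prod_i h i (S i) = \prod_i (h i true - h i false).
Proof.
transitivity (\prod_(i < d) \sum_(s : bool) (-1) ^+ (~~ s) * h i s).
  by rewrite bigA_distr_bigA; apply: eq_bigr => S _; rewrite -big_split.
by apply: eq_bigr => i _; rewrite big_bool /= mul1r mulN1r.
Qed.

(* Inclusion-exclusion: only surjective, hence injective, words [g] survive. *)
Lemma polarization (A : {ffun 'I_d -> 'I_d} -> R) :
  \sum_S subset_sign S * (\sum_(g : {ffun 'I_d -> 'I_d}) (\prod_t (S (g t))%:R) * A g) =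
  \sum_(g : {ffun 'I_d -> 'I_d} | injectiveb g) A g.
Proof.
under eq_bigr do rewrite mulr_sumr.
rewrite exchange_big /= [RHS]big_mkcond /=; apply: eq_bigr => g _.
under eq_bigr do rewrite mulrA.
rewrite -mulr_suml.
pose h (i : 'I_d) (s : bool) : R := \prod_(t | g t == i) s%:R.
have -> : \sum_S subset_sign S * (\prod_t (S (g t))%:R) = \prod_i (h i true - h i false).
  rewrite -sum_subset_sign; apply: eq_bigr => S _; congr (_ * _).
  rewrite (partition_big g xpredT)//=; apply: eq_bigr => i _.
  by apply: eq_bigr => t /eqP ->.
have hT i : h i true = 1 by rewrite /h big1.
have hF i : h i false = (i \notin codom g)%:R.
  have [/codomP[t ->]|ig] := boolP (i \in codom g).
    by rewrite /h (bigD1 t)//= mul0r.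
  rewrite /h big_pred0// => t; apply/negbTE; apply: contraNneq ig => <-.
  exact: codom_f.
case: ifP => [/injectiveP ginj|gninj].
  rewrite big1 ?mul1r// => i _; rewrite hT hF.
  have [ginv _ gK] := injF_bij ginj.
  by rewrite -[i]gK codom_f subr0.
have [i ig] : exists i, i \notin codom g.
  apply/existsP; apply: contraFT gninj => /existsPn gsurj.
  suff /image_injP gi : #|codom g| == #|'I_d|.
    by apply/injectiveP => i j; apply: gi.
  by apply/eqP/eq_card => i; have /negbNE := gsurj i; rewrite !inE => ->.
by rewrite (bigD1 i)//= hT hF ig subrr !mul0r.
Qed.

Lemma sum_injective_const (c : R) :
  \sum_(g : {ffun 'I_d -> 'I_d} | injectiveb g) c = (d`!)%:R * c.
Proof.
rewrite sumr_const -[LHS]mulr_natl; congr (_%:R * _).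
have := card_inj_ffuns 'I_d 'I_d; rewrite !card_ord ffactnn => <-.
by rewrite cardsE.
Qed.

End Polarization.

(** * Weighted Minkowski sums in a vector space *)

Section MinkowskiSums.
Variables (R : realType) (N : vectType R).
Implicit Types (P Q : set N) (V : {vspace N}).

Definition minkowski_sum k (lam : 'I_k -> R) (P : 'I_k -> set N) : set N :=
  [set x | exists2 v : 'I_k -> N, forall i, P i (v i) & x = \sum_i lam i *: v i].

Lemma convex_hull_nth (s : seq N) (i : 'I_(size s)) : convex_hull s s`_i.
Proof.
exists (fun j => (j == i)%:R); first split=> [j|]; first exact: ler0n.
  by rewrite (bigD1 i)//= big1 ?eqxx ?addr0 => [//|j /negbTE ->].
by rewrite (bigD1 i)//= big1 ?eqxx ?addr0 ?scale1r => [//|j /negbTE ->]; rewrite scale0r.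
Qed.

Lemma convex_hull_nonempty (s : seq N) : s != [::] -> convex_hull s !=set0.
Proof. by case: s => // x s _; exists x; exact: (@convex_hull_nth (x :: s) ord0). Qed.

Lemma polytope_nonempty V P : polytope_in V P -> P !=set0.
Proof. by move=> [s [s0 _ ->]]; exact: convex_hull_nonempty. Qed.

(** Normalize the weights. If their total is 0 they all vanish and any point of the hull serves,
    which is where nonemptiness enters. *)
Lemma convex_hull_sum (I : finType) (s : seq N) (mu : I -> R) (v : I -> N) :
  s != [::] -> (forall i, 0 <= mu i) -> (forall i, convex_hull s (v i)) ->
  exists2 x, convex_hull s x & \sum_i mu i *: v i = (\sum_i mu i) *: x.
Proof.
move=> s0 mu0 vP.
have /boolp.choice[c cP] : forall i, exists c : 'I_(size s) -> R,
    ((forall m, 0 <= c m) /\ \sum_m c m = 1) /\ \sum_m c m *: s`_m = v i.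
  by move=> i; have [c c01 cE] := vP i; exists c.
have [M0|MN0] := eqVneq (\sum_i mu i) 0.
  have mui i : mu i = 0.
    by move: M0 => /eqP; rewrite psumr_eq0// => /allP/(_ i (mem_index_enum _))/eqP.
  have [y ys] := convex_hull_nonempty s0; exists y => //.
  by rewrite M0 scale0r big1// => i _; rewrite mui scale0r.
set M := \sum_i mu i; exists (M^-1 *: \sum_i mu i *: v i); last by rewrite scalerA divff// scale1r.
exists (fun m => M^-1 * \sum_i mu i * c i m).
  split=> [m|].
    rewrite mulr_ge0 ?invr_ge0 ?sumr_ge0// => i _; rewrite mulr_ge0//.
    by have [[]] := cP i.
  rewrite -mulr_sumr exchange_big /= (eq_bigr mu) ?mulVf// => i _.
  by rewrite -mulr_sumr; have [[_ ->]] := cP i; rewrite mulr1.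
rewrite scaler_sumr; under eq_bigr do rewrite -scalerA scaler_suml scaler_sumr.
rewrite exchange_big /=; apply: eq_bigr => i _; have [_ <-] := cP i.
by rewrite !scaler_sumr; apply: eq_bigr => m _; rewrite !scalerA.
Qed.

Section Volume.
Variables (b : seq N) (V : {vspace N}).
Hypothesis bV : basis_of V b.
Local Notation d := (size b).
Local Notation bt := (in_tuple b).
Local Notation vol := (normalized_volume b).

Lemma basis_expand x : x \in V -> x = \sum_(i < d) coord bt i x *: b`_i.
Proof. by move=> xV; rewrite {1}(@coord_basis _ _ _ _ bt _ bV xV). Qed.

Lemma minkowski_sum_polynomial k (P : 'I_k -> set N) :
  (forall i, polytope_in V (P i)) ->
  exists (I : finType) (v : I -> R) (e : I -> 'I_k -> nat),
    (forall m, v m != 0 -> (\sum_i e m i)%N = d) /\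
    forall lam, (forall i, 0 <= lam i) ->
      vol (minkowski_sum lam P) = \sum_m v m * \prod_i lam i ^+ e m i.
Proof.
move=> /boolp.choice[s sP].
(* A vertex is a position in one of the generating lists, so equal points in different polytopes
   keep separate labels. *)
pose J : finType := {i : 'I_k & 'I_(size (s i))}.
pose pt (j : J) : N := (s (tag j))`_(tagged j).
pose p (j : J) : 'rV[R]_d := \row_m coord bt m (pt j).
pose l (j : J) : 'I_k := tag j.
have ptV j : pt j \in V.
  by have [_ sV _] := sP (tag j); apply: sV; rewrite mem_nth.
have lsurj i : exists j, l j = i.
  have [s0 _ _] := sP i; rewrite -size_eq0 -lt0n in s0.
  by exists (Tagged (fun i => 'I_(size (s i))) (Ordinal s0)).
have [v [e [ev volE]]] := minkowski_polynomial p lsurj.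
exists {set J}, (fun m => (d`!)%:R * v m), e; split.
  by move=> m vm; apply: ev; apply: contraNneq vm => ->; rewrite mulr0.
move=> lam lam0; pose lamr : 'rV[R]_k := \row_i lam i.
have lamr0 i : 0 <= lamr 0 i by rewrite mxE.
under eq_bigr do rewrite -mulrA.
rewrite -mulr_sumr /normalized_volume; congr (_ * _).
transitivity (fine (lebesgue_iter (weighted_sum p l lamr))); last first.
  rewrite volE//=; apply: eq_bigr => m _; congr (_ * _).
  by apply: eq_bigr => i _; rewrite mxE.
congr (fine (lebesgue_iter _)).
have sum_tag (A : nmodType) (F : J -> A) :
    \sum_j F j = \sum_i \sum_(m < size (s i)) F (Tagged (fun i => 'I_(size (s i))) m).
  rewrite (sig_big_dep xpredT (fun _ => xpredT)
    (fun i (m : 'I_(size (s i))) => F (Tagged (fun i => 'I_(size (s i))) m))).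
  by apply: eq_bigr => -[].
have coordE t (c : J -> R) : rowt t = \sum_j c j *: p j <->
    \sum_(m < d) tnth t m *: b`_m = \sum_j c j *: pt j.
  have ptE j : pt j = \sum_(m < d) p j 0 m *: b`_m.
    by rewrite [LHS]basis_expand//; apply: eq_bigr => m _; rewrite mxE.
  have bfree : free bt by case/andP: bV.
  split=> [tE|tE].
    under [RHS]eq_bigr do rewrite ptE scaler_sumr.
    rewrite exchange_big /=; apply: eq_bigr => m _.
    have /rowP/(_ m) := tE; rewrite mxE summxE => ->.
    by rewrite scaler_suml; apply: eq_bigr => j _; rewrite mxE scalerA.
  apply/rowP => m; rewrite mxE summxE.
  rewrite -(coord_sum_free (fun m => tnth t m) m bfree) /= tE linear_sum /=.
  by apply: eq_bigr => j _; rewrite linearZ /= [RHS]mxE [p j 0 m]mxE.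
apply/seteqP; split=> t /=.
- move=> [x xP tE].
  have cex i : exists c : 'I_(size (s i)) -> R,
      [/\ forall m, 0 <= c m, \sum_m c m = 1 & x i = \sum_m c m *: (s i)`_m].
    have := xP i; have [_ _ ->] := sP i.
    by move=> [c [c0 c1] <-]; exists c.
  pose c i := sval (cid (cex i)).
  have cP i := svalP (cid (cex i)); rewrite -/(c _) in cP.
  exists (fun j => lam (tag j) * c (tag j) (tagged j)).
    by move=> j; have [c0 _ _] := cP (tag j); apply: mulr_ge0; [exact: lam0|exact: c0].
  rewrite (cayley_sum p l id); congr row_mx.
    apply/coordE; rewrite tE sum_tag; apply: eq_bigr => i _.
    have [_ _ ->] := cP i; rewrite scaler_sumr; apply: eq_bigr => m _.
    by rewrite scalerA.
  apply/rowP => i; rewrite !mxE big_mkcond sum_tag (bigD1 i)//= [X in _ + X]big1 => [|i' i'i].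
    have [_ c1 _] := cP i; rewrite addr0 -[LHS]mulr1 -c1 mulr_sumr.
    by apply: eq_bigr => m _; rewrite eqxx.
  by rewrite big1// => m _; rewrite (negbTE i'i).
- move=> /weighted_sum_label[c c0 [/coordE -> cE]].
  pose ci i (m : 'I_(size (s i))) := c (Tagged (fun i => 'I_(size (s i))) m).
  have lamE i : lam i = \sum_m ci i m.
    have := cE i; rewrite mxE => ->.
    rewrite big_mkcond sum_tag (bigD1 i)//= [X in _ + X]big1 => [|i' i'i].
      by rewrite addr0; apply: eq_bigr => m _; rewrite eqxx.
    by rewrite big1// => m _; rewrite (negbTE i'i).
  have /boolp.choice[x xP] : forall i, exists x,
      P i x /\ \sum_m ci i m *: (s i)`_m = lam i *: x.
    move=> i; have [s0 _ ->] := sP i.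
    have [x xs xE] := @convex_hull_sum _ (s i) (ci i) (fun m => (s i)`_m) s0
       (fun m => c0 _) (@convex_hull_nth (s i)).
    by exists x; rewrite lamE -xE.
  exists x; first by move=> i; have [] := xP i.
  rewrite sum_tag; apply: eq_bigr => i _; have [_ <-] := xP i.
  by apply: eq_bigr.
Qed.

End Volume.
End MinkowskiSums.

(** * Existence of the mixed volume *)

Section MixedVolume.
Variables (R : realType) (N : vectType R) (b : seq N) (V : {vspace N}).
Hypothesis bV : basis_of V b.
Local Notation d := (size b).
Local Notation vol := (normalized_volume b).

Definition polarized_volume (P : 'I_d -> set N) : R :=
  (d`!)%:R^-1 * \sum_S subset_sign R S * vol (minkowski_sum (fun i => (S i)%:R) P).

Lemma polarized_volume_sym (P : 'I_d -> set N) (p : 'S_d) :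
  polarized_volume (P \o p) = polarized_volume P.
Proof.
congr (_ * _).
pose h (S : {ffun 'I_d -> bool}) := [ffun i => S (p i)].
rewrite (reindex_inj (h := h)) /=; last first.
  move=> S S' /ffunP SS'; apply/ffunP => i.
  by have := SS' (p^-1 i)%g; rewrite !ffunE permKV.
apply: eq_bigr => S _; congr (_ * _).
  rewrite /subset_sign [RHS](reindex_perm p) /=.
  by apply: eq_bigr => i _; rewrite ffunE.
congr vol; apply/seteqP; split=> x /= [v vP ->].
  exists (v \o (p^-1)%g); first by move=> i /=; have := vP (p^-1 i)%g; rewrite /= permKV.
  by rewrite [RHS](reindex_perm p); apply: eq_bigr => i _; rewrite ffunE /= permK.
exists (v \o p); first by move=> i /=.
by rewrite (reindex_perm p); apply: eq_bigr => i _; rewrite ffunE.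
Qed.

(** By convexity a weighted sum of copies of [P] is a dilate of [P], and Minkowski's polynomial for
    a single polytope gives homogeneity of degree [d]. Polarizing the power of the total weight
    leaves the [d!] injective words. *)
Lemma polarized_volume_diag P : polytope_in V P -> polarized_volume (fun=> P) = vol P.
Proof.
move=> PV.
have [I [v [e [ev volE]]]] := minkowski_sum_polynomial bV (P := fun _ : 'I_1 => P) (fun=> PV).
have scale (mu : R) : 0 <= mu ->
    vol (minkowski_sum (fun _ : 'I_1 => mu) (fun=> P)) = mu ^+ d * \sum_m v m.
  move=> mu0; rewrite volE// mulr_sumr; apply: eq_bigr => m _.
  have [->|vm] := eqVneq (v m) 0; first by rewrite mul0r mulr0.
  by rewrite big_ord1 -(ev m vm) big_ord1 mulrC.
have P1 : minkowski_sum (fun _ : 'I_1 => 1) (fun=> P) = P.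
  apply/seteqP; split=> [x [y yP ->]|x xP]; first by rewrite big_ord1 scale1r.
  by exists (fun=> x); rewrite ?big_ord1 ?scale1r.
have volP : vol P = \sum_m v m by rewrite -{1}P1 scale// expr1n mul1r.
have sumE (lam : 'I_d -> R) : (forall i, 0 <= lam i) ->
    vol (minkowski_sum lam (fun=> P)) = (\sum_i lam i) ^+ d * vol P.
  move=> lam0; rewrite volP -scale ?sumr_ge0//; congr vol.
  have [s [s0 _ Ps]] := PV.
  apply/seteqP; split=> x /= [y yP ->]; last first.
    exists (fun=> y ord0) => //.
    by rewrite [LHS]big_ord1 scaler_suml.
  rewrite Ps in yP; have [x' x'P E] := convex_hull_sum s0 lam0 yP.
  by exists (fun=> x'); [rewrite Ps | rewrite big_ord1 E].
rewrite /polarized_volume.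
under eq_bigr do rewrite sumE//.
have powE (S : {ffun 'I_d -> bool}) : (\sum_i (S i)%:R) ^+ d * vol P =
    \sum_(g : {ffun 'I_d -> 'I_d}) (\prod_t (S (g t))%:R) * vol P.
  rewrite -mulr_suml; congr (_ * _).
  (* The exponent is read as the cardinality of ['I_d], so that the power becomes a product that
     distributes over words. *)
  by rewrite -{8}(card_ord d) -prodr_const bigA_distr_bigA.
under eq_bigr do rewrite powE.
rewrite polarization sum_injective_const mulrA mulVf ?mul1r//.
Qed.

(* The product over [j != i0] vanishes unless all these exponents are positive,
   which leaves total degree at most one for the variables of [P i0] and [Q]. *)
Lemma multilinear_factor (I : finType) (i0 : I) (e : I -> nat) (e' : nat) (x y : R) :
  (\sum_i e i + e')%N = #|I| ->
  let L x y := (\prod_(j | j != i0) (1 - 0 ^+ e j)) *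
    (x ^+ e i0 * y ^+ e' - 0 ^+ e i0 * 0 ^+ e') in
  L x y = x * L 1 0 + y * L 0 1.
Proof.
move=> esum L; rewrite /L {L}.
have [/existsP[j /andP[ji /eqP ej]]|/existsPn epos] := boolP [exists j, (j != i0) && (e j == 0)%N].
  by rewrite (bigD1 j)//= ej expr0 subrr !mul0r !mulr0 addr0.
have : (#|I|.-1 <= \sum_(j | j != i0) e j)%N.
  rewrite -(cardC1 i0) -sum1_card; apply: leq_sum => j; rewrite inE /= lt0n => ji.
  by have := epos j; rewrite ji.
have I0 : (0 < #|I|)%N by apply/card_gt0P; exists i0.
move: esum; rewrite (bigD1 i0)//=; set A := (\sum_(_ | _) _)%N => esum Age.
have : (e i0 + e' <= 1)%N.
  by rewrite -(leq_add2r A) addnAC esum -(prednK I0) add1n ltnS.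
case: (e i0) => [|[|?]]; case: e' {esum} => [|[|?]] // _.
- by rewrite !expr0 !mulr1 subrr !mulr0 addr0.
- by rewrite !expr0 !expr1 !mul1r !subr0 mulr0 mulr1 mulr0 add0r mulrC.
- by rewrite !expr0 !expr1 !mulr1 subr0 !subr0 mulr0 mulr1 mulr0 addr0 mulrC.
Qed.

(** Splitting slot [i0] into two polytopes of weights [x] and [y] gives [d + 1] polytopes with one
    volume polynomial. Inclusion-exclusion acts on each monomial separately and leaves [L m x y], to
    which [multilinear_factor] applies. *)
Lemma polarized_volume_comb (P : 'I_d -> set N) i0 Q :
  (forall j, polytope_in V (P j)) -> polytope_in V Q ->
  exists C D, forall x y, 0 <= x -> 0 <= y ->
    polarized_volume [eta P with i0 |-> minkowski_comb x y (P i0) Q] = x * C + y * D.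
Proof.
move=> PV QV.
pose P' (i : 'I_(d + 1)) := if fintype.split i is inl j then P j else Q.
have P'V i : polytope_in V (P' i) by rewrite /P'; case: (fintype.split i).
have [I [v [e [ev volE]]]] := minkowski_sum_polynomial bV P'V.
pose L m (x y : R) := (\prod_(j | j != i0) (1 - 0 ^+ e m (lshift 1 j))) *
    (x ^+ e m (lshift 1 i0) * y ^+ e m (rshift d ord0) -
     0 ^+ e m (lshift 1 i0) * 0 ^+ e m (rshift d ord0)).
exists ((d`!)%:R^-1 * \sum_m v m * L m 1 0), ((d`!)%:R^-1 * \sum_m v m * L m 0 1).
move=> x y x0 y0.
rewrite /polarized_volume (mulrCA x) (mulrCA y) -mulrDr; congr (_ * _).
pose lam (S : {ffun 'I_d -> bool}) (i : 'I_(d + 1)) : R :=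
  match fintype.split i with
  | inl j => if j == i0 then x * (S i0)%:R else (S j)%:R
  | inr _ => y * (S i0)%:R
  end.
have lam0 S i : 0 <= lam S i.
  by rewrite /lam; case: (fintype.split i) => j; [case: eqP|]; rewrite ?mulr_ge0.
have lamL S j : lam S (lshift 1 j) = if j == i0 then x * (S i0)%:R else (S j)%:R.
  by rewrite /lam (unsplitK (inl j)).
have lamR S : lam S (rshift d ord0) = y * (S i0)%:R.
  by rewrite /lam (unsplitK (inr ord0)).
have P'L j : P' (lshift 1 j) = P j by rewrite /P' (unsplitK (inl j)).
have P'R : P' (rshift d ord0) = Q by rewrite /P' (unsplitK (inr ord0)).
have sumE (S : {ffun 'I_d -> bool}) : minkowski_sum (fun i => (S i)%:R)
    [eta P with i0 |-> minkowski_comb x y (P i0) Q] = minkowski_sum (lam S) P'.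
  apply/seteqP; split=> z [w wP ->].
    have := wP i0; rewrite /= eqxx => -[u uP [u' u'Q wE]].
    exists (fun i => match fintype.split i with
      | inl j => if j == i0 then u else w j | inr _ => u' end).
      move=> i; rewrite /P'; case: (fintype.split i) => j //; have := wP j; rewrite /=.
      by case: eqP => // ->.
    rewrite big_split_ord big_ord1 /= lamR (unsplitK (inr ord0)).
    rewrite (bigD1 i0)//= [in RHS](bigD1 i0)//= lamL (unsplitK (inl i0)) eqxx.
    rewrite -wE scalerDr !scalerA ![_ * (S i0)%:R]mulrC -!addrA; congr (_ + _).
    rewrite addrC; congr (_ + _); apply: eq_bigr => j /negbTE ji.
    by rewrite lamL (unsplitK (inl j)) ji.
  exists (fun j => if j == i0 then x *: w (lshift 1 i0) + y *: w (rshift d ord0)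
                   else w (lshift 1 j)).
    move=> j /=; case: eqP => [_|_]; last by rewrite -P'L.
    exists (w (lshift 1 i0)); first by rewrite -P'L.
    by exists (w (rshift d ord0)); rewrite // -P'R.
  rewrite big_split_ord big_ord1 /= lamR.
  rewrite (bigD1 i0)//= [in RHS](bigD1 i0)//= lamL eqxx.
  rewrite scalerDr !scalerA ![_ * (S i0)%:R]mulrC -!addrA; congr (_ + _).
  rewrite [RHS]addrC; congr (_ + _); apply: eq_bigr => j /negbTE ji.
  by rewrite lamL ji.
transitivity (\sum_m v m * L m x y); last first.
  rewrite !mulr_sumr -big_split /=; apply: eq_bigr => m _.
  rewrite (mulrCA x) (mulrCA y) -mulrDr.
  have [->|vm] := eqVneq (v m) 0; first by rewrite !mul0r.
  have esum : (\sum_(j < d) e m (lshift 1 j) + e m (rshift d ord0))%N = #|'I_d|.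
    by have := ev _ vm; rewrite big_split_ord big_ord1 card_ord.
  by congr (_ * _); exact: (multilinear_factor i0 x y esum).
under eq_bigr => S _ do rewrite sumE (volE _ (lam0 S)) mulr_sumr.
rewrite exchange_big /=; apply: eq_bigr => m _.
under eq_bigr do rewrite mulrCA.
rewrite -mulr_sumr; congr (_ * _).
(* The weights of [P i0] and [Q] share the indicator [S i0], so both powers belong to the factor at
   [i0]. *)
pose h (j : 'I_d) (s : bool) : R :=
  if j == i0 then (x * s%:R) ^+ e m (lshift 1 i0) * (y * s%:R) ^+ e m (rshift d ord0)
  else s%:R ^+ e m (lshift 1 j).
transitivity (\sum_S subset_sign R S * \prod_j h j (S j)).
  apply: eq_bigr => S _; congr (_ * _).
  rewrite big_split_ord big_ord1 /= lamR (bigD1 i0)//= [in RHS](bigD1 i0)//=.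
  rewrite lamL {1}/h eqxx mulrAC; congr (_ * _).
  by apply: eq_bigr => j /negbTE ji; rewrite lamL /h ji.
rewrite sum_subset_sign (bigD1 i0)//= mulrC /L /h eqxx !mulr1 !mulr0; congr (_ * _).
by apply: eq_bigr => j /negbTE ->; rewrite expr1n.
Qed.

Theorem mixed_volume_exists : is_mixed_volume V vol polarized_volume.
Proof.
split=> [P p _|P i Q x y PV QV x0 y0|P PV].
- exact: polarized_volume_sym.
- have [C [D CD]] := polarized_volume_comb i PV QV.
  (* [C] and [D] are the values at weights (1, 0) and (0, 1). There the combination is [P i],
     respectively [Q], because the other polytope is nonempty. *)
  have [u0 u0P] := polytope_nonempty (PV i); have [w0 w0Q] := polytope_nonempty QV.
  rewrite CD//; congr (_ * _ + _ * _).
    rewrite -[C]mul1r -[1 * C]addr0 -(mul0r D) -CD// ; congr polarized_volume.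
    apply/funext => j /=; case: eqP => // ->.
    apply/seteqP; split=> [z [u uP [w wQ <-]]|z zP]; first by rewrite scale1r scale0r addr0.
    by exists z => //; exists w0; rewrite // scale1r scale0r addr0.
  rewrite -[D]mul1r -[1 * D]add0r -(mul0r C) -CD//; congr polarized_volume.
  apply/funext => j /=; case: eqP => // _.
  apply/seteqP; split=> [z [u uP [w wQ <-]]|z zP]; first by rewrite scale1r scale0r add0r.
  by exists u0 => //; exists z; rewrite // scale1r scale0r add0r.
- exact: polarized_volume_diag.
Qed.

End MixedVolume.

(** * Truncated simplicial cones *)

Section SimplicialCone.
Variables (R : realType) (N : vectType R) (ip : {dot N for idfun}).
Variables (m : nat) (u : 'I_m -> N).
Hypothesis u_indep : forall c : 'I_m -> R, \sum_i c i *: u i = 0 -> forall i, c i = 0.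
Implicit Types (I J : {set 'I_m}) (z : 'I_m -> R).

Definition face_span I : set N :=
  [set x | exists2 c : 'I_m -> R, forall i, i \notin I -> c i = 0 & x = \sum_i c i *: u i].

Definition face_cone I : set N :=
  [set x | exists2 c : 'I_m -> R, forall i, 0 <= c i /\ (i \notin I -> c i = 0) &
    x = \sum_i c i *: u i].

(** Characterizes $w_{\tau,*}(z)$ for the face $\tau$ generated by the [u i] with [i] in [I]. *)
Definition is_face_point I z w :=
  face_span I w /\ forall i, i \in I -> ip w (u i) = z i.

Lemma indep_coef (c c' : 'I_m -> R) :
  \sum_i c i *: u i = \sum_i c' i *: u i -> forall i, c i = c' i.
Proof.
move=> E i; apply/eqP; rewrite -subr_eq0; apply/eqP.
apply: (u_indep (c := fun i => c i - c' i)).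
by under eq_bigr do rewrite scalerBl; rewrite sumrB E subrr.
Qed.

Lemma ip_sum x (c : 'I_m -> R) : ip x (\sum_i c i *: u i) = \sum_i c i * ip x (u i).
Proof. by rewrite linear_sumr; apply: eq_bigr => i _; rewrite linearZr_LR. Qed.

Lemma ip_self_ge0 (x : N) : 0 <= ip x x.
Proof.
have [->|x0] := eqVneq x 0; first by rewrite linear0r.
by rewrite ltW// neq0_dnorm_gt0.
Qed.

Lemma ip_self_le0 (x : N) : ip x x <= 0 -> x = 0.
Proof.
move=> x0; apply/eqP; apply: contraLR x0 => x0.
by rewrite -ltNge neq0_dnorm_gt0.
Qed.

Lemma face_span_orth I x : face_span I x -> (forall i, i \in I -> ip x (u i) = 0) -> x = 0.
Proof.
move=> [c cI xE] x0; apply: ip_self_le0; rewrite {2}xE ip_sum big1// => i _.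
by have [/x0 ->|/cI ->] := boolP (i \in I); rewrite ?mulr0 ?mul0r.
Qed.

Lemma face_spanD I a b x y : face_span I x -> face_span I y ->
  face_span I (a *: x + b *: y).
Proof.
move=> [c cI ->] [c' c'I ->]; exists (fun i => a * c i + b * c' i).
  by move=> i iI; rewrite cI// c'I// !mulr0 addr0.
rewrite !scaler_sumr -big_split /=; apply: eq_bigr => i _.
by rewrite scalerDl !scalerA.
Qed.

Lemma face_spanB I x y : face_span I x -> face_span I y -> face_span I (x - y).
Proof. by move=> hx hy; have := face_spanD 1 (-1) hx hy; rewrite scale1r scaleN1r. Qed.

Lemma is_face_point_unique I z w w' :
  is_face_point I z w -> is_face_point I z w' -> w = w'.
Proof.
move=> [sw wz] [sw' w'z]; apply/eqP; rewrite -subr_eq0; apply/eqP.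
apply: (face_span_orth (face_spanB sw sw')) => i iI.
by rewrite linearBl /= wz// w'z// subrr.
Qed.

Lemma is_face_point_exists I z : exists w, is_face_point I z w.
Proof.
(* The Gram matrix of [I], completed by the identity to keep the size [m]. A kernel vector yields a
   point of the span of [I] orthogonal to that span. *)
pose G : 'M[R]_m := \matrix_(i, j)
  if (i \in I) && (j \in I) then ip (u i) (u j) else (i == j)%:R.
have inG (c : 'rV[R]_m) j : j \in I ->
    (c *m G) 0 j = ip (\sum_i (if i \in I then c 0 i else 0) *: u i) (u j).
  move=> jI; rewrite mxE linear_sumlz; apply: eq_bigr => i _; rewrite mxE jI andbT linearZl_LR /=.
  case: ifP => [//|iI]; rewrite mul0r; case: eqP => [ij|_]; last by rewrite mulr0.
  by rewrite ij jI in iI.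
have notinG (c : 'rV[R]_m) j : j \notin I -> (c *m G) 0 j = c 0 j.
  move=> jI; rewrite mxE (bigD1 j)//= big1 => [|i /negbTE ij].
    by rewrite mxE (negbTE jI) eqxx mulr1 addr0.
  by rewrite mxE (negbTE jI) andbF ij mulr0.
have uG : G \in unitmx.
  apply: unitmx_row_inj => c c0; apply/rowP => j; rewrite [RHS]mxE.
  have [jI|jI] := boolP (j \in I); last by rewrite -notinG// c0 mxE.
  have x0 : \sum_i (if i \in I then c 0 i else 0) *: u i = 0.
    apply: (@face_span_orth I).
      by exists (fun i => if i \in I then c 0 i else 0) => // i /negbTE ->.
    by move=> i iI; rewrite -inG// c0 mxE.
  by have := u_indep x0 j; rewrite jI.
pose c := (\row_i z i) *m invmx G.
exists (\sum_i (if i \in I then c 0 i else 0) *: u i); split.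
  by exists (fun i => if i \in I then c 0 i else 0) => // i /negbTE ->.
by move=> i iI; rewrite -inG// mulmxKV// mxE.
Qed.

Definition face_point I z : N := sval (cid (is_face_point_exists I z)).

Lemma face_pointP I z : is_face_point I z (face_point I z).
Proof. exact: svalP (cid (is_face_point_exists I z)). Qed.

Lemma face_point_linear I z z' lambda :
  face_point I (lambda *: z + z') = lambda *: face_point I z + face_point I z'.
Proof.
have [sw wz] := face_pointP I z; have [sw' wz'] := face_pointP I z'.
apply: (is_face_point_unique (face_pointP I _)); split.
  by rewrite -[X in _ + X]scale1r; exact: face_spanD.
by move=> i iI; rewrite linearDl linearZl_LR /= wz// wz'.
Qed.

Definition truncated_cone z : set N :=
  [set v | face_cone [set: 'I_m] v /\ forall i, ip v (u i) <= z i].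

Definition face_points_hull z : set N :=
  convex_hull [seq face_point K z | K <- enum {: {set 'I_m}}].

Lemma face_points_hullP z x : face_points_hull z x <->
  exists2 c : {set 'I_m} -> R, (forall I, 0 <= c I) /\ \sum_I c I = 1 &
    x = \sum_I c I *: face_point I z.
Proof.
rewrite /face_points_hull; set s := map _ _.
have ss : #|{: {set 'I_m}}| = size s by rewrite size_map -cardE.
pose rk (K : {set 'I_m}) : 'I_(size s) := cast_ord ss (enum_rank K).
pose un (i : 'I_(size s)) : {set 'I_m} := enum_val (cast_ord (esym ss) i).
have rkK : cancel rk un by move=> K; rewrite /un /rk cast_ordK enum_rankK.
have unK : cancel un rk by move=> i; rewrite /un /rk enum_valK cast_ordKV.
have sE (i : 'I_(size s)) : s`_i = face_point (un i) z.
  rewrite (nth_map finset.set0) -?cardE ?ss//.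
  by congr face_point; rewrite /un (enum_val_nth finset.set0).
split=> [[c [c0 c1] <-]|[c [c0 c1] ->]].
  exists (c \o rk); first split=> [K|]; first exact: c0.
    by rewrite -c1 (reindex rk)//; exists un => K _.
  rewrite (reindex rk) /=; last by exists un => K _.
  by apply: eq_bigr => K _; congr (_ *: _); rewrite -[in RHS](rkK K) -sE.
exists (c \o un); first split=> [K|]; first exact: c0.
  by rewrite -c1 (reindex un)//; exists rk => K _.
rewrite [RHS](reindex un) /=; last by exists rk => K _.
by apply: eq_bigr => i _; rewrite sE.
Qed.

(* The orthogonal increment from [face_point I z] to [face_point (k |: I) z] has a
   nonnegative [u k]-coefficient, hence a nonnegative product with [u k]. *)
Lemma face_point_le I z k : face_cone (k |: I) (face_point (k |: I) z) -> k \notin I ->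
  ip (face_point I z) (u k) <= z k.
Proof.
move=> [c cP cE] kI; set w := face_point I z.
have [[c' c'I wE] wz] := face_pointP I z; rewrite -/w in wE wz.
have [_ w'z] := face_pointP (k |: I) z; rewrite cE in w'z; set w' := \sum_i _ in cE w'z.
have orth i : i \in I -> ip (w' - w) (u i) = 0.
  by move=> iI; rewrite linearBl /= w'z ?wz ?subrr// finset.in_setU iI orbT.
have nE : ip (w' - w) (w' - w) = c k * ip (w' - w) (u k).
  have {2}-> : w' - w = \sum_i (c i - c' i) *: u i.
    by under eq_bigr do rewrite scalerBl; rewrite sumrB -wE.
  rewrite ip_sum (bigD1 k)//= big1 ?addr0 => [|i ik]; first by rewrite (c'I _ kI) subr0.
  have [/orth ->|iI] := boolP (i \in I); first by rewrite mulr0.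
  by rewrite c'I// (cP i).2 ?subrr ?mul0r// finset.in_setU1 (negbTE ik).
have n0 := ip_self_ge0 (w' - w).
have E : ip (w' - w) (u k) = z k - ip w (u k).
  by rewrite linearBl /= w'z// finset.in_setU1 eqxx.
have [ck0|ck] := eqVneq (c k) 0.
  have : w' - w = 0 by apply: ip_self_le0; rewrite nE ck0 mul0r.
  by move/eqP: E => + n; rewrite n linear0l eq_sym subr_eq0 => /eqP ->.
have ck0 : 0 < c k by rewrite lt_neqAle eq_sym ck (cP k).1.
by rewrite -subr_ge0 -E -(pmulr_rge0 _ ck0) -nE.
Qed.

(* The ray from [face_point I z] through [v] never violates the upper bounds, so
   it can only leave the truncated cone through a proper face. *)
Lemma truncated_face_sub_hull z I v : face_cone I v -> (forall i, i \in I -> ip v (u i) <= z i) ->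
  face_points_hull z v.
Proof.
elim/ltn_ind: {I}#|I| {-2}I v (erefl #|I|) => n IHn I v In [a aP vE] vz.
have [[a' a'I wE] wz] := face_pointP I z; set w := face_point I z in wE wz.
have qE : v - w = \sum_i (a i - a' i) *: u i.
  by under eq_bigr do rewrite scalerBl; rewrite sumrB -wE -vE.
have qz i : i \in I -> ip (v - w) (u i) <= 0.
  by move=> iI; rewrite linearBl /= wz// subr_le0 vz.
have bI i : i \notin I -> a i - a' i = 0 by move=> iI; rewrite a'I// (aP i).2// subrr.
(* If no coefficient of [v - w] is negative, then [qz] makes its square norm nonpositive, so [v] is
   the face point. *)
have [/existsP[k0 k0P]|/existsPn b_ge0] := boolP [exists i, a i - a' i < 0]; last first.
  have -> : v = w.
    apply/eqP; rewrite -subr_eq0; apply/eqP/ip_self_le0.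
    rewrite {2}qE ip_sum; apply: sumr_le0 => i _.
    have [iI|iI] := boolP (i \in I); last by rewrite bI// mul0r.
    by rewrite mulr_ge0_le0 ?qz// leNgt b_ge0.
  apply/face_points_hullP; exists (fun J => (J == I)%:R); first split.
  - by move=> J; rewrite ler0n.
  - by rewrite (bigD1 I)//= eqxx big1 ?addr0// => J /negbTE ->.
  - by rewrite (bigD1 I)//= eqxx scale1r big1 ?addr0// => J /negbTE ->; rewrite scale0r.
(* The time at which coefficient [i] reaches 0 on the ray [v + t *: (v - w)]; the first such time
   gives the exit point. *)
pose ratio i := a i / - (a i - a' i).
case: (@arg_minP _ _ _ k0 (fun i => a i - a' i < 0) ratio k0P) => k kP kmin.
set t := ratio k.
have kI : k \in I by apply: contraLR kP => /bI ->; rewrite ltxx.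
have t0 : 0 <= t by rewrite divr_ge0 ?(aP k).1// oppr_ge0 ltW.
pose v' := v + t *: (v - w).
have v'E : v' = \sum_i (a i + t * (a i - a' i)) *: u i.
  rewrite /v' qE {1}vE scaler_sumr -big_split; apply: eq_bigr => i _.
  by rewrite [RHS]scalerDl scalerA.
have v'k : a k + t * (a k - a' k) = 0.
  have b0 : a k - a' k != 0 by rewrite lt_eqF.
  by rewrite /t /ratio invrN mulrN mulNr divfK// subrr.
have : face_points_hull z v'.
  apply: (IHn #|I :\ k| _ (I :\ k)) => //.
  - by rewrite -In [X in (_ < X)%N](cardsD1 k) kI.
  - exists (fun i => a i + t * (a i - a' i)) => // i; split.
      have [b0|b0] := ltP (a i - a' i) 0; last first.
        by apply: addr_ge0; [exact: (aP i).1 | exact: mulr_ge0].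
      have : t <= ratio i := kmin i b0.
      by rewrite /ratio ler_pdivlMr ?oppr_gt0// mulrN -subr_ge0 opprK.
    rewrite finset.in_setD1 negb_and negbK => /orP[/eqP -> //|iI].
    by rewrite bI// mulr0 addr0 (aP i).2.
  - move=> i; rewrite finset.in_setD1 => /andP[_ iI].
    rewrite linearDl linearZl_LR /= (le_trans _ (vz _ iI))// gerDl.
    by rewrite mulr_ge0_le0 ?qz.
move=> /face_points_hullP[c [c0 c1] v'c]; apply/face_points_hullP.
have t1 : 0 < 1 + t by rewrite ltr_pwDl.
(* These coefficients express [v] as [(v' + t w) / (1 + t)]. *)
exists (fun J => (c J + t * (J == I)%:R) / (1 + t)).
  split=> [J|]; first by apply: divr_ge0; [apply: addr_ge0 => //; exact: mulr_ge0 | exact: ltW].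
  rewrite -mulr_suml big_split /= c1 (bigD1 I)//= eqxx big1 ?addr0 => [|J /negbTE ->].
    by rewrite mulr1 divff// gt_eqF.
  by rewrite mulr0.
apply: (scalerI (lt0r_neq0 t1)); rewrite scaler_sumr.
transitivity (v' + t *: w).
  by rewrite /v' scalerBr -addrA subrK scalerDl scale1r.
under eq_bigr do rewrite scalerA mulrCA divff ?gt_eqF// mulr1 scalerDl.
rewrite big_split /= -v'c; congr (_ + _).
rewrite (bigD1 I)//= eqxx mulr1 big1 ?addr0// => J /negbTE ->.
by rewrite mulr0 scale0r.
Qed.

(** The conditions of the truncated cone are convex, and each face point satisfies them: the bounds
    are equalities on its own face and follow from [face_point_le] elsewhere. *)
Lemma truncated_coneE z : (forall I, face_cone I (face_point I z)) ->
  truncated_cone z = face_points_hull z.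
Proof.
move=> cub; apply/seteqP; split=> v.
  by move=> [vc vz]; apply: (truncated_face_sub_hull vc) => i _; exact: vz.
move=> /face_points_hullP[c [c0 c1] ->]; split.
  have /boolp.choice[a aP] : forall I, exists a : 'I_m -> R,
      (forall i, 0 <= a i) /\ face_point I z = \sum_i a i *: u i.
    by move=> I; have [a aP aE] := cub I; exists a; split=> // i; have [] := aP i.
  exists (fun i => \sum_I c I * a I i).
    move=> i; split; last by rewrite inE.
    by rewrite sumr_ge0// => I _; rewrite mulr_ge0//; have [] := aP I.
  under eq_bigr do rewrite (aP _).2 scaler_sumr.
  rewrite exchange_big /=; apply: eq_bigr => i _.
  by rewrite scaler_suml; apply: eq_bigr => I _; rewrite scalerA.
move=> k; rewrite linear_sumlz -[z k]mul1r -c1 mulr_suml; apply: ler_sum => I _.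
rewrite linearZl_LR /= ler_wpM2l//.
have [kI|kI] := boolP (k \in I); first by have [_ ->] := face_pointP I z.
exact: face_point_le.
Qed.

(** A point on the left is a convex combination of face points; as these are linear in [z], the same
    coefficients give its two summands. The other inclusion adds inequalities. *)
Lemma truncated_cone_comb z z' lambda : (forall I, face_cone I (face_point I z)) ->
  (forall I, face_cone I (face_point I z')) -> 0 <= lambda ->
  truncated_cone (lambda *: z + z') =
  minkowski_comb lambda 1 (truncated_cone z) (truncated_cone z').
Proof.
move=> cz cz' l0; apply/seteqP; split=> x; last first.
  move=> [v [[a a0 ->] vz] [v' [[a' a'0 ->] v'z]] <-]; split.
    exists (fun i => lambda * a i + a' i).
      by move=> i; split; [rewrite addr_ge0 ?mulr_ge0 ?(a0 i).1 ?(a'0 i).1// | rewrite inE].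
    rewrite scale1r scaler_sumr -big_split; apply: eq_bigr => i _.
    by rewrite [RHS]scalerDl scalerA.
  move=> i; rewrite scale1r linearDl linearZl_LR /= lerD//.
  exact: ler_wpM2l.
move=> xP; have : face_points_hull (lambda *: z + z') x.
  by case: xP => xc xz; apply: (truncated_face_sub_hull xc) => i _; exact: xz.
move=> /face_points_hullP[c c01 ->].
have inP y : (forall I, face_cone I (face_point I y)) ->
    truncated_cone y (\sum_I c I *: face_point I y).
  by move=> cy; rewrite truncated_coneE//; apply/face_points_hullP; exists c.
exists (\sum_I c I *: face_point I z); first exact: inP.
exists (\sum_I c I *: face_point I z'); first exact: inP.
rewrite scale1r scaler_sumr -big_split; apply: eq_bigr => I _.
by rewrite face_point_linear scalerDr !scalerA mulrC.
Qed.

End SimplicialCone.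

(** * Cones of a simplicial fan *)

Section PolyhedralCones.
Variables (R : realType) (N : vectType R).

Lemma lin_span_eq (C : set N) (V : {vspace N}) : C `<=` [set` V] ->
  (forall W : {vspace N}, C `<=` [set` W] -> (V <= W)%VS) -> lin_span C = V.
Proof.
move=> CV Vmin; rewrite /lin_span.
set S := (X in xget _ X).
have [|CS Smin] := @xgetPex _ 0%VS S; first by exists V.
by apply/eqP; rewrite eqEsubv Smin//= Vmin.
Qed.

Definition conic m (u : 'I_m -> N) : set N :=
  [set x | exists2 c : 'I_m -> R, forall i, 0 <= c i & x = \sum_i c i *: u i].

Definition half_line (x : N) : set N := [set y | exists2 t : R, 0 <= t & y = t *: x].

Definition irredundant m (u : 'I_m -> N) : Prop := forall i (c : 'I_m -> R),
  (forall j, 0 <= c j) -> c i = 0 -> u i <> \sum_j c j *: u j.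

Lemma conic_hullE (s : seq N) : conic_hull s = conic (fun i : 'I_(size s) => s`_i).
Proof. by apply/seteqP; split=> x [c c0 E]; exists c. Qed.

Lemma conic_gen m (u : 'I_m -> N) i : conic u (u i).
Proof.
exists (fun j => (j == i)%:R) => //.
by rewrite (bigD1 i)//= eqxx scale1r big1 ?addr0// => j /negbTE ->; rewrite scale0r.
Qed.

(** A generating family of least cardinality is irredundant. *)
Lemma irredundant_generators (C : set N) : polyhedral_cone C ->
  exists m (u : 'I_m -> N), C = conic u /\ irredundant u.
Proof.
move=> [s Cs]; pose P m := `[< exists u : 'I_m -> N, C = conic u >].
have exP : exists m, P m.
  by exists (size s); apply/asboolP; exists (fun i => s`_i); rewrite Cs conic_hullE.
case: (ex_minnP exP) => m /asboolP[u Cu] mmin; exists m, u; split=> // i c c0 ci uE.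
case: m => [|m] in u Cu mmin i c c0 ci uE *; first by case: (i).
have /mmin : P m; last by rewrite ltnn.
apply/asboolP; exists (u \o lift i); rewrite Cu; apply/seteqP; split=> x [b b0 ->].
  exists (fun j => b i * c (lift i j) + b (lift i j)).
    by move=> j; rewrite addr_ge0// mulr_ge0.
  rewrite (bigD1_ord i)//= uE (bigD1_ord i)//= ci scale0r add0r scaler_sumr -big_split.
  by apply: eq_bigr => j _; rewrite scalerDl scalerA.
exists (fun j => if unlift i j is Some k then b k else 0).
  by move=> j; case: unlift.
rewrite (bigD1_ord i)//= unlift_none scale0r add0r.
by apply: eq_bigr => j _; rewrite liftK.
Qed.

(** If two points of the cone sum to a multiple of [u i], their parts along the other generators
    also sum to a multiple of [u i]. A positive multiple contradicts irredundancy; otherwise the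
    part [y] and its negative both lie in the cone, so [y] vanishes. *)
Lemma half_line_face (C : set N) m (u : 'I_m -> N) i :
  C = conic u -> strongly_convex C -> irredundant u -> is_face (half_line (u i)) C.
Proof.
move=> -> sc irr; split.
- split=> [|a b v w a0 b0 [t t0 ->] [t' t'0 ->]]; first by exists 0; rewrite ?scale0r.
  exists (a * t + b * t'); first by rewrite addr_ge0 ?mulr_ge0.
  by rewrite scalerDl !scalerA.
- move=> _ [t t0 ->]; exists (fun j => if j == i then t else 0).
    by move=> j; case: eqP.
  by rewrite (bigD1 i)//= eqxx big1 ?addr0// => j /negbTE ->; rewrite scale0r.
- have main (a b : 'I_m -> R) t : (forall j, 0 <= a j) -> (forall j, 0 <= b j) ->
      \sum_j a j *: u j + \sum_j b j *: u j = t *: u i -> half_line (u i) (\sum_j a j *: u j).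
    move=> a0 b0 E; exists (a i) => //.
    pose y := \sum_(j | j != i) a j *: u j.
    suff y0 : y = 0 by rewrite (bigD1 i)//= -/y y0 addr0.
    have E' : y + \sum_(j | j != i) b j *: u j = (t - a i - b i) *: u i.
      move: E; rewrite (bigD1 i)//= -/y [X in _ + X = _](bigD1 i)//= => E.
      by rewrite !scalerBl -E addrACA -scalerDl -[RHS]addrA -opprD -scalerDl addrAC subrr add0r.
    have sle : t - a i - b i <= 0.
      rewrite leNgt; apply/negP => s0.
      apply: (irr i (fun j => if j == i then 0 else (t - a i - b i)^-1 * (a j + b j))).
      - by move=> j; case: eqP => // _; apply: mulr_ge0; [rewrite invr_ge0 ltW | exact: addr_ge0].
      - by rewrite eqxx.
      - rewrite (bigD1 i)//= eqxx scale0r add0r.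
        transitivity ((t - a i - b i)^-1 *: (y + \sum_(j | j != i) b j *: u j)).
          by rewrite E' scalerA mulVf ?scale1r// gt_eqF.
        rewrite -big_split scaler_sumr; apply: eq_bigr => j /negbTE -> /=.
        by rewrite -scalerDl scalerA.
    apply: sc.
      exists (fun j => if j == i then 0 else a j); first by move=> j; case: eqP.
      rewrite [RHS](bigD1 i)//= eqxx scale0r add0r.
      by apply: eq_bigr => j /negbTE ->.
    exists (fun j => if j == i then - (t - a i - b i) else b j).
      by move=> j; case: eqP => //; rewrite oppr_ge0.
    rewrite [RHS](bigD1 i)//= eqxx scaleNr -E' opprD -addrA.
    rewrite [X in _ + (_ + X)](eq_bigr (fun j => b j *: u j)) => [|j /negbTE -> //].
    by rewrite addNr addr0.
  move=> v w [a a0 ->] [b b0 ->] [t t0 E]; split; first exact: main E.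
  by apply: (main b a t) => //; rewrite addrC.
Qed.

Lemma lin_span_conic m (u : 'I_m -> N) : lin_span (conic u) = (\sum_(i < m) <[u i]>)%VS.
Proof.
apply: lin_span_eq => [x [c c0 ->]|W CW].
  by apply/memv_sumP; exists (fun i => c i *: u i) => // i _; rewrite memvZ ?memv_line.
by apply/subv_sumP => i _; rewrite -memvE; apply: CW; exact: conic_gen.
Qed.

Lemma cone_dim_half_line x : x != 0 -> cone_dim (half_line x) = 1%N.
Proof.
move=> x0; rewrite /cone_dim (@lin_span_eq _ <[x]>%VS) ?dim_vline ?x0//.
  by move=> _ [t t0 ->]; rewrite /= memvZ ?memv_line.
by move=> W HW; rewrite -memvE; apply: HW; exists 1; rewrite ?scale1r.
Qed.

Lemma dim_sum_lines m (u : 'I_m -> N) : (\dim (\sum_(i < m) <[u i]>)%VS <= m)%N.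
Proof.
rewrite (leq_trans (dimv_leq_sum _ _ _))// -[X in (_ <= X)%N](card_ord m) -sum1_card.
by apply: leq_sum => i _; rewrite dim_vline; case: eqP.
Qed.

Lemma indep_of_dim m (u : 'I_m -> N) : \dim (\sum_(i < m) <[u i]>)%VS = m ->
  forall c : 'I_m -> R, \sum_i c i *: u i = 0 -> forall i, c i = 0.
Proof.
move=> dm c c0 i; apply/eqP; apply: contraT => ci.
case: m => [|m] in u dm c c0 i ci *; first by case: (i).
suff : (\dim (\sum_(j < m.+1) <[u j]>)%VS <= m)%N by rewrite dm ltnn.
rewrite (leq_trans _ (dim_sum_lines (u \o lift i)))// dimvS//.
apply/subv_sumP => j _; rewrite -memvE.
have lifted k : u (lift i k) \in (\sum_(j < m) <[(u \o lift i) j]>)%VS.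
  by rewrite memvE (sumv_sup k).
case: (unliftP i j) => [k|] ->; first exact: lifted.
have -> : u i = - (c i)^-1 *: \sum_(k < m) c (lift i k) *: u (lift i k).
  move: c0; rewrite (bigD1_ord i)//= => /eqP; rewrite addr_eq0 => /eqP E.
  by rewrite scaleNr -scalerN -E scalerA mulVf// scale1r.
by rewrite memvZ// memv_suml// => k _; rewrite memvZ.
Qed.

End PolyhedralCones.

(** * Rays and faces of a cone of the fan *)

Section FanCones.
Variables (R : realType) (N : vectType R) (Sigma : marked_fan N).
Hypothesis hsimp : simplicial Sigma.

Lemma is_face_trans (A C D : set N) : is_face A C -> is_face C D -> is_face A D.
Proof.
move=> [ccA AC fA] [_ CD fC]; split=> // [x /AC/CD //|v w vD wD Avw].
have [vC wC] := fC v w vD wD (AC _ Avw); exact: fA.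
Qed.

Lemma is_face_sub (A C D : set N) : is_face A D -> A `<=` C -> C `<=` D -> is_face A C.
Proof.
by move=> [ccA AD fA] AC CD; split=> // v w /CD vD /CD wD; exact: fA.
Qed.

Lemma face_cone_setT m (u : 'I_m -> N) : face_cone u [set: 'I_m]%SET = conic u.
Proof.
apply/seteqP; split=> x [c c0 ->]; exists c => // i; first by have [] := c0 i.
by split; [exact: c0 | rewrite inE].
Qed.

Lemma mark_gen (rho : ray Sigma) x : val rho = half_line x ->
  exists2 t, 0 < t & mark rho = t *: x.
Proof.
move=> rx; have := mark_in rho; rewrite rx => -[t t0 E]; exists t => //.
rewrite lt_neqAle t0 andbT; apply/eqP => t00.
by have := mark_neq0 rho; rewrite E -t00 scale0r eqxx.
Qed.

Lemma half_line_scale (x : N) t : 0 < t -> half_line (t *: x) = half_line x.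
Proof.
move=> t0; apply/seteqP; split=> _ [a a0 ->].
  by exists (a * t); rewrite ?scalerA// mulr_ge0// ltW.
by exists (a / t); rewrite ?scalerA ?divfK ?gt_eqF// divr_ge0// ltW.
Qed.

Lemma conic_scale m (u u' : 'I_m -> N) :
  (forall i, exists2 t : R, 0 < t & u' i = t *: u i) -> conic u' = conic u.
Proof.
move=> uu'; have /boolp.choice[t tP] : forall i, exists t : R, 0 < t /\ u' i = t *: u i.
  by move=> i; have [t t0 E] := uu' i; exists t.
apply/seteqP; split=> x [c c0 ->].
  exists (fun i => c i * t i); first by move=> i; rewrite mulr_ge0// ltW// (tP i).1.
  by apply: eq_bigr => i _; rewrite (tP i).2 scalerA.
exists (fun i => c i / t i); first by move=> i; rewrite divr_ge0// ltW// (tP i).1.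
by apply: eq_bigr => i _; rewrite (tP i).2 scalerA divfK// gt_eqF// (tP i).1.
Qed.

(** The [m] irredundant generators lie on distinct rays, so [m] is at most the number of rays, which
    is the dimension; they also span, so the dimension is at most [m]. Equality shows that every ray
    is hit and that the generators are independent. *)
Lemma simplicial_cone_rays s : cones Sigma s ->
  exists m (r : 'I_m -> ray Sigma),
    [/\ cone_dim s = m /\ injective r, rays_of s = range r,
        (forall i, val (r i) = half_line (mark (r i))),
        (forall c : 'I_m -> R, \sum_i c i *: mark (r i) = 0 -> forall i, c i = 0) &
        s = conic (fun i => mark (r i))].
Proof.
move=> Ss; have [m [u [su irr]]] := irredundant_generators (cones_polyhedral Ss).
have sc := cones_strongly_convex Ss.
have u0 i : u i != 0.
  apply/eqP => ui0; apply: (irr i (fun=> 0)) => //.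
  by rewrite ui0 big1// => j _; rewrite scale0r.
have rface i := half_line_face i su sc irr.
have /boolp.choice[r rP] : forall i, exists rho : ray Sigma, val rho = half_line (u i).
  move=> i; have H : cones_of_dim (cones Sigma) 1 (half_line (u i)).
    by split; [exact: (cones_face Ss (rface i)) | exact: cone_dim_half_line].
  by exists (exist _ (half_line (u i)) (mem_set H)).
have rinj : injective r.
  move=> i j rij; apply/eqP; apply: contraT => ij; exfalso.
  have : half_line (u j) (u i).
    by rewrite -rP -rij rP; exists 1; rewrite ?scale1r.
  move=> [t t0 uE]; apply: (irr i (fun k => if k == j then t else 0)).
  - by move=> k; case: eqP.
  - by rewrite (negbTE ij).
  - by rewrite (bigD1 j)//= eqxx big1 ?addr0// => k /negbTE ->; rewrite scale0r.
have rin i : rays_of s (r i) by rewrite /rays_of /= rP.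
have dimE : cone_dim s = \dim (\sum_(i < m) <[u i]>)%VS by rewrite /cone_dim su lin_span_conic.
have fin : finite_set (rays_of s : set (ray Sigma)) by exists (cone_dim s); exact: (hsimp Ss).
have cardF : size (fset_set (rays_of s : set (ray Sigma))) = cone_dim s by exact: (card_fset_set (hsimp Ss)).
pose B := [seq r i | i <- enum 'I_m].
have uB : uniq B by rewrite map_inj_uniq ?enum_uniq.
have sB : size B = m by rewrite size_map size_enum_ord.
have BF : {subset B <= fset_set (rays_of s : set (ray Sigma))}.
  by move=> _ /mapP[i _ ->]; rewrite in_fset_set// inE.
have le_m : (cone_dim s <= m)%N by rewrite dimE dim_sum_lines.
have le_B : (size (fset_set (rays_of s : set (ray Sigma))) <= size B)%N by rewrite cardF sB.
have [sz BFE] := uniq_min_size uB BF le_B.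
have dm : cone_dim s = m by rewrite -cardF -sz.
have um i := mark_gen (rP i).
have ind : forall c : 'I_m -> R, \sum_i c i *: u i = 0 -> forall i, c i = 0.
  by apply: indep_of_dim; rewrite -dimE.
exists m, r; split=> //.
- apply/seteqP; split=> [rho rhos|_ [i _ <-] //].
  have : rho \in B by rewrite BFE in_fset_set// inE.
  by move=> /mapP[i _ ->]; exists i.
- by move=> i; have [t t0 ->] := um i; rewrite half_line_scale.
- move=> c c0 i.
  have /boolp.choice[tt ttP] : forall i, exists t : R, 0 < t /\ mark (r i) = t *: u i.
    by move=> j; have [t' t'0 E'] := um j; exists t'.
  have : \sum_i (c i * tt i) *: u i = 0.
    by rewrite -[RHS]c0; apply: eq_bigr => j _; rewrite (ttP j).2 scalerA.
  by move=> /ind/(_ i)/eqP; rewrite mulf_eq0 (gt_eqF (ttP i).1) orbF => /eqP.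
- by rewrite {1}su; apply/esym/conic_scale.
Qed.

Section OneCone.
Variables (s : set N) (m : nat) (r : 'I_m -> ray Sigma).
Hypotheses (Ss : cones Sigma s) (rinj : injective r) (rays_s : rays_of s = range r).
Hypothesis r_line : forall i, val (r i) = half_line (mark (r i)).
Local Notation u := (fun i => mark (r i)).
Hypothesis ind : forall c : 'I_m -> R, \sum_i c i *: u i = 0 -> forall i, c i = 0.
Hypothesis su : s = conic u.
Implicit Types J : {set 'I_m}.

Lemma face_cone_sub J : face_cone u J `<=` s.
Proof. by rewrite su => _ [c cJ ->]; exists c => // i; have [] := cJ i. Qed.

Lemma face_cone_is_face J : is_face (face_cone u J) s.
Proof.
split; last 2 first.
- exact: face_cone_sub.
- rewrite su => _ _ [a a0 ->] [b b0 ->] [c cJ].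
  rewrite -big_split /= => E.
  have {}E : \sum_i (a i + b i) *: u i = \sum_i c i *: u i.
    by rewrite -E; apply: eq_bigr => j _; rewrite scalerDl.
  have {}E := indep_coef ind E.
  have ab0 i : i \notin J -> a i = 0 /\ b i = 0.
    move=> iJ; have /eqP := E i; rewrite (cJ i).2// paddr_eq0// => /andP[/eqP -> /eqP ->].
    by [].
  by split; [exists a|exists b] => // i; split=> // /ab0[].
- split; first by exists (fun=> 0) => //; rewrite big1// => i _; rewrite scale0r.
  move=> a b _ _ a0 b0 [c cJ ->] [c' c'J ->]; exists (fun i => a * c i + b * c' i).
    move=> i; split=> [|iJ]; last by rewrite (cJ i).2// (c'J i).2// !mulr0 addr0.
    by rewrite addr_ge0 ?mulr_ge0 ?(cJ i).1 ?(c'J i).1.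
  rewrite !scaler_sumr -big_split; apply: eq_bigr => i _.
  by rewrite [RHS]scalerDl !scalerA.
Qed.

(** This makes pseudocubicality available for every subset of the rays, as [truncated_coneE]
    requires. *)
Lemma face_cone_cone J : cones Sigma (face_cone u J).
Proof. exact: (cones_face Ss (face_cone_is_face J)). Qed.

Lemma face_cone_gen J i : face_cone u J (u i) <-> i \in J.
Proof.
have uE : u i = \sum_j (j == i)%:R *: u j.
  by rewrite (bigD1 i)//= eqxx scale1r big1 ?addr0// => j /negbTE ->; rewrite scale0r.
split=> [[c cJ E]|iJ].
  apply: contraT => /(cJ i).2 ci0.
  have := indep_coef ind (etrans (esym uE) E) i.
  by rewrite eqxx ci0 => /eqP; rewrite oner_eq0.
exists (fun j => (j == i)%:R) => // j; split=> // jJ.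
by case: eqP => // ji; rewrite -ji (negbTE jJ) in iJ.
Qed.

Lemma rays_of_face_cone J : rays_of (face_cone u J) = [set r i | i in [set i | i \in J]].
Proof.
apply/seteqP; split=> [rho rhoJ|_ [i iJ <-]].
  have : rays_of s rho by exact: (is_face_trans rhoJ (face_cone_is_face J)).
  rewrite rays_s => -[i _ ri]; exists i => //=; apply/face_cone_gen.
  by have [_ sub _] := rhoJ; apply: sub; rewrite ri; exact: mark_in.
have ri : rays_of s (r i) by rewrite rays_s; exists i.
apply: (is_face_sub ri); last exact: face_cone_sub.
rewrite r_line => _ [t t0 ->]; have /face_cone_gen[c cJ ->] := iJ.
exists (fun j => t * c j); last by rewrite scaler_sumr; apply: eq_bigr => j _; rewrite scalerA.
by move=> j; split=> [|/(cJ j).2 ->]; rewrite ?mulr0// mulr_ge0// (cJ j).1.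
Qed.

Lemma lin_span_face_cone J x : x \in lin_span (face_cone u J) <-> face_span u J x.
Proof.
have -> : lin_span (face_cone u J) = (\sum_(i in J) <[u i]>)%VS.
  apply: lin_span_eq => [_ [c cJ ->]|W HW].
    rewrite /= (bigID (mem J)) /= [X in _ + X]big1 ?addr0 => [|i /(cJ i).2 ->].
      by apply/memv_sumP; exists (fun i => c i *: u i) => // i _; rewrite memvZ ?memv_line.
    by rewrite scale0r.
  by apply/subv_sumP => i iJ; rewrite -memvE; apply: HW; apply/face_cone_gen.
split=> [/memv_sumP[v vP ->]|[c cJ ->]].
  have /boolp.choice[c cP] : forall i, exists c : R, i \in J -> v i = c *: u i.
    move=> i; have [iJ|iJ] := boolP (i \in J); last by exists 0.
    by have /vlineP[c E] := vP i iJ; exists c.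
  exists (fun i => if i \in J then c i else 0) => [i /negbTE -> //|].
  rewrite big_mkcond; apply: eq_bigr => i _; case: ifP => [/cP //|_].
  by rewrite scale0r.
rewrite (bigID (mem J)) /= [X in _ + X]big1 ?addr0 => [|i /cJ ->]; last by rewrite scale0r.
by apply/memv_sumP; exists (fun i => c i *: u i) => // i _; rewrite memvZ ?memv_line.
Qed.

End OneCone.
End FanCones.

(** * Pseudocubical values and their polytopes *)

Section CubicalPolytopes.
Variables (R : realType) (N : vectType R) (Sigma : marked_fan N).
Hypothesis hsimp : simplicial Sigma.
Variable ip : {dot N for idfun}.

Section OneCone.
Variables (s : set N) (m : nat) (r : 'I_m -> ray Sigma).
Hypotheses (Ss : cones Sigma s) (rinj : injective r) (rays_s : rays_of s = range r).
Hypothesis r_line : forall i, val (r i) = half_line (mark (r i)).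
Local Notation u := (fun i => mark (r i)).
Hypothesis ind : forall c : 'I_m -> R, \sum_i c i *: u i = 0 -> forall i, c i = 0.
Hypothesis su : s = conic u.
Implicit Types (J : {set 'I_m}) (z : ray Sigma -> R).

Lemma cub_vector_face J z :
  cub_vector ip (face_cone u J) z = face_point ip ind J (z \o r).
Proof.
rewrite /cub_vector; set S := (X in xget _ X).
have SE w : S w <-> is_face_point ip u J (z \o r) w.
  split=> [[/(lin_span_face_cone ind) ws wz]|[ws wz]]; split=> //.
  - move=> i iJ; apply: (wz (r i)).
    by rewrite (rays_of_face_cone rays_s r_line ind su); exists i.
  - exact/(lin_span_face_cone ind).
  - by move=> rho; rewrite (rays_of_face_cone rays_s r_line ind su) => -[i iJ <-]; exact: wz.
have Sp : S (face_point ip ind J (z \o r)) by apply/SE; exact: face_pointP.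
have Sx : S (xget 0 S) by apply: xgetPex; exists (face_point ip ind J (z \o r)).
by apply: (is_face_point_unique _ (face_pointP ip ind J (z \o r))); apply/SE.
Qed.

Lemma pseudocubical_face J z : pseudocubical ip z ->
  face_cone u J (face_point ip ind J (z \o r)).
Proof.
move=> /(_ (face_cone u J)) h; rewrite -cub_vector_face; apply: h.
exact: (face_cone_cone Ss ind su).
Qed.

Lemma cub_polytopeE z : cub_polytope ip s z = truncated_cone ip u (z \o r).
Proof.
have sE : s = face_cone u [set: 'I_m]%SET by rewrite face_cone_setT.
apply/seteqP; split=> v [sv vz]; split.
- by rewrite -sE.
- by move=> i; apply: vz; rewrite rays_s; exists i.
- by rewrite sE.
- by move=> rho; rewrite rays_s => -[i _ <-]; exact: vz.
Qed.

Lemma lin_span_cone x : x \in lin_span s <-> face_span u [set: 'I_m]%SET x.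
Proof. by rewrite {1}su -face_cone_setT; exact: lin_span_face_cone. Qed.

Lemma polytope_cub_polytope z : pseudocubical ip z ->
  polytope_in (lin_span s) (cub_polytope ip s z).
Proof.
move=> cz; rewrite cub_polytopeE (truncated_coneE (u_indep := ind)); last first.
  by move=> J; exact: pseudocubical_face.
eexists; split; last reflexivity.
  rewrite -size_eq0 size_map -cardE.
  by apply/negP => /eqP/card0_eq/(_ finset.set0).
move=> _ /mapP[J _ ->]; apply/lin_span_cone.
have [[c _ ->] _] := face_pointP ip ind J (z \o r).
by exists c => // i; rewrite inE.
Qed.

Lemma cub_polytope_comb z z' lambda : pseudocubical ip z -> pseudocubical ip z' ->
  0 <= lambda -> cub_polytope ip s (lambda *: z + z') =
  minkowski_comb lambda 1 (cub_polytope ip s z) (cub_polytope ip s z').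
Proof.
move=> cz cz' l0; rewrite !cub_polytopeE.
exact: (truncated_cone_comb (u_indep := ind) (fun J => pseudocubical_face J cz)
  (fun J => pseudocubical_face J cz') l0).
Qed.

Lemma cub_vector_comb z z' lambda : pseudocubical ip z -> pseudocubical ip z' ->
  0 <= lambda -> s (cub_vector ip s (lambda *: z + z')).
Proof.
move=> cz cz' l0; have sE : s = face_cone u [set: 'I_m]%SET by rewrite face_cone_setT.
rewrite {1 2}sE cub_vector_face.
have -> : (lambda *: z + z') \o r = lambda *: (z \o r) + (z' \o r) by [].
rewrite face_point_linear.
have [c cP ->] := pseudocubical_face [set: 'I_m]%SET cz.
have [c' c'P ->] := pseudocubical_face [set: 'I_m]%SET cz'.
exists (fun i => lambda * c i + c' i).
  move=> i; split; last by rewrite inE.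
  by apply: addr_ge0; [apply: mulr_ge0 => //; exact: (cP i).1 | exact: (c'P i).1].
rewrite scaler_sumr -big_split; apply: eq_bigr => i _.
by rewrite [RHS]scalerDl scalerA.
Qed.

Lemma size_dual_basis : cone_dim s = m -> size (dual_basis Sigma ip s) = m.
Proof. by move=> <-; rewrite size_map; exact: (card_fset_set (hsimp Ss)). Qed.

(** The size is the dimension, so spanning suffices. A vector [x] of the span has the same products
    with the markings as the combination of dual vectors with coefficients [ip x (mark (r i))], and
    face points are unique. *)
Lemma basis_dual_basis : cone_dim s = m -> basis_of (lin_span s) (dual_basis Sigma ip s).
Proof.
move=> dm; rewrite basisEdim size_dual_basis// -dm leqnn andbT.
apply/subvP => x xs.
pose e (rho : ray Sigma) := cub_vector ip s (fun rho' : ray Sigma => (rho' == rho)%:R).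
have sE : s = face_cone u [set: 'I_m]%SET by rewrite face_cone_setT.
have eP i : is_face_point ip u [set: 'I_m]%SET (fun j => (r j == r i)%:R) (e (r i)).
  rewrite /e {1}sE cub_vector_face; exact: face_pointP.
have -> : x = \sum_i ip x (mark (r i)) *: e (r i).
  apply: (is_face_point_unique (ip := ip) (I := [set: 'I_m]%SET) (z := fun j => ip x (mark (r j)))).
    by split=> //; apply/lin_span_cone.
  split.
    have /boolp.choice[c cP] : forall i, exists c : 'I_m -> R, e (r i) = \sum_j c j *: u j.
      by move=> i; have [[c _ E] _] := eP i; exists c.
    exists (fun j => \sum_i ip x (mark (r i)) * c i j); first by move=> i; rewrite inE.
    under eq_bigr do rewrite cP scaler_sumr.
    rewrite exchange_big; apply: eq_bigr => j _.
    by rewrite scaler_suml; apply: eq_bigr => i _; rewrite scalerA.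
  move=> j jT; rewrite linear_sumlz (bigD1 j)//= big1 ?addr0 => [|i /negbTE ij].
    by rewrite linearZl_LR /= (eP j).2// eqxx mulr1.
  rewrite linearZl_LR /= (eP i).2// (inj_eq rinj) eq_sym ij mulr0 //.
rewrite memv_suml// => i _; rewrite memvZ// memv_span//.
apply: map_f; rewrite in_fset_set; first by rewrite rays_s inE; exists i.
by exists (cone_dim s); exact: (hsimp Ss).
Qed.

End OneCone.

Lemma pseudocubical_comb (z z' : ray Sigma -> R) lambda : pseudocubical ip z -> pseudocubical ip z' ->
  0 <= lambda -> pseudocubical ip (lambda *: z + z').
Proof.
move=> cz cz' l0 s Ss.
have [m [r [[dm rinj] rays_s r_line ind su]]] := simplicial_cone_rays hsimp Ss.
exact: (cub_vector_comb Ss rays_s r_line ind su).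
Qed.

Lemma pseudocubical0 : pseudocubical ip (0 : ray Sigma -> R).
Proof.
move=> s Ss.
have [m [r [[dm rinj] rays_s r_line ind su]]] := simplicial_cone_rays hsimp Ss.
have sE : s = face_cone (fun i => mark (r i)) [set: 'I_m]%SET by rewrite face_cone_setT.
rewrite {2}sE (cub_vector_face rays_s r_line ind su).
rewrite (_ : face_point _ _ _ _ = 0).
  by rewrite su; exists (fun=> 0) => //; rewrite big1// => i _; rewrite scale0r.
apply: (is_face_point_unique (face_pointP ip ind _ _)); split.
  by exists (fun=> 0) => //; rewrite big1// => i _; rewrite scale0r.
by move=> i _; rewrite linear0l.
Qed.

Lemma mvol_coneP d s : cones_of_dim (cones Sigma) d s ->
  is_mixed_volume (lin_span s) (@vol_cone _ _ Sigma ip s) (@mvol_cone _ _ Sigma ip d s).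
Proof.
move=> [Ss ds].
have [m [r [[dm rinj] rays_s r_line ind su]]] := simplicial_cone_rays hsimp Ss.
apply: xgetPex.
have bV := basis_dual_basis Ss rinj rays_s r_line ind su dm.
have sb : size (dual_basis Sigma ip s : seq N) = d.
  by rewrite (size_dual_basis Ss dm) -dm.
(* [polarized_volume] is indexed by the size of its basis, so [d] is replaced by that size. *)
rewrite /vol_cone; case: d / sb ds => ds.
by exists (@polarized_volume _ _ (dual_basis Sigma ip s)); exact: mixed_volume_exists.
Qed.

End CubicalPolytopes.

(** * Polarization on pseudocubical values *)

Section MultilinearExpansion.
Variables (R : realType) (N : vectType R) (Sigma : marked_fan N) (d : nat).
Hypothesis hsimp : simplicial Sigma.
Variable ip : {dot N for idfun}.
Variable H : ('I_d -> ray Sigma -> R) -> R.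
Hypothesis H_lin : cub_multilinear ip H.
Local Notation W := (ray Sigma -> R).
Local Notation cub := (@pseudocubical R N Sigma ip).

Lemma pseudocubical_sum n (c : 'I_n -> R) (z : 'I_n -> W) :
  (forall i, 0 <= c i) -> (forall i, cub (z i)) -> cub (\sum_i c i *: z i).
Proof.
move=> c0 zC; elim/big_ind: _ => [|x y xC yC|i _].
- exact: pseudocubical0.
- by rewrite -[x]scale1r; exact: pseudocubical_comb.
- by rewrite -[_ *: _]addr0; apply: pseudocubical_comb => //; exact: pseudocubical0.
Qed.

Lemma multilinear0 (y : 'I_d -> W) t : (forall j, cub (y j)) ->
  H [eta y with t |-> 0 : W] = 0.
Proof.
move=> yC; set y0 : 'I_d -> W := [eta y with t |-> 0 : W].
have y0C j : cub (y0 j) by rewrite /y0 /=; case: eqP => // _; exact: pseudocubical0.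
(* As [1 *: 0 + 0] is 0, multilinearity says that [H y0] is its own double. *)
have := H_lin t y0C (pseudocubical0 hsimp ip) ler01.
have -> : [eta y0 with t |-> 1 *: y0 t + 0] = y0 :> ('I_d -> W).
  by apply/funext => j; rewrite /y0 /= eqxx scaler0 addr0; case: eqP.
have -> : [eta y0 with t |-> 0 : W] = y0 :> ('I_d -> W).
  by apply/funext => j; rewrite /y0 /=; case: eqP.
by rewrite mul1r => /eqP; rewrite -subr_eq0 opprD addrA subrr add0r oppr_eq0 => /eqP.
Qed.

Lemma multilinear_sum (y : 'I_d -> W) t n (c : 'I_n -> R) (z : 'I_n -> W) :
  (forall j, cub (y j)) -> (forall i, 0 <= c i) -> (forall i, cub (z i)) ->
  H [eta y with t |-> \sum_i c i *: z i] = \sum_i c i * H [eta y with t |-> z i].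
Proof.
move=> yC; elim: n c z => [|n IHn] c z c0 zC.
  by rewrite !big_ord0 multilinear0.
rewrite !big_ord_recl -IHn//.
set x := \sum_(i < n) _.
have xC : cub x by apply: pseudocubical_sum.
pose y1 : 'I_d -> W := [eta y with t |-> z ord0].
have y1C j : cub (y1 j) by rewrite /y1 /=; case: eqP.
have := H_lin t y1C xC (c0 ord0).
have -> : [eta y1 with t |-> c ord0 *: y1 t + x] = [eta y with t |-> c ord0 *: z ord0 + x] :> ('I_d -> W).
  by apply/funext => j; rewrite /y1 /= eqxx; case: eqP.
have -> // : [eta y1 with t |-> x] = [eta y with t |-> x] :> ('I_d -> W).
by apply/funext => j; rewrite /y1 /=; case: eqP.
Qed.

Lemma multilinear_expand (z : 'I_d -> W) (c : 'I_d -> 'I_d -> R) :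
  (forall i, cub (z i)) -> (forall t i, 0 <= c t i) ->
  H (fun t => \sum_i c t i *: z i) =
  \sum_(g : {ffun 'I_d -> 'I_d}) (\prod_t c t (g t)) * H (z \o g).
Proof.
(* Slots from [k] on are pure: slot [t] holds the single vector [z (g0 t)]. Each inductive step
   expands one more slot; at 0 only the word [g0] contributes. *)
move=> zC; suff main k (g0 : 'I_d -> 'I_d) : forall c : 'I_d -> 'I_d -> R,
    (forall t i, 0 <= c t i) -> (forall t : 'I_d, (k <= t)%N -> c t =1 fun i => (i == g0 t)%:R) ->
    H (fun t => \sum_i c t i *: z i) =
    \sum_(g : {ffun 'I_d -> 'I_d}) (\prod_t c t (g t)) * H (z \o g).
  by move=> c0; apply: (main d id) => // t; rewrite leqNgt ltn_ord.
elim: k g0 => [|k IHk] g0 {}c c0 pure.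
  pose g1 : {ffun 'I_d -> 'I_d} := finfun g0.
  rewrite (bigD1 g1)//= big1 => [|t _]; last by rewrite pure// ffunE eqxx.
  rewrite mul1r [X in _ = _ + X]big1 ?addr0 => [|g gg1]; last first.
    have [t gt] : exists t, g t != g0 t.
      apply/existsP; apply: contraNT gg1 => /existsPn h; apply/eqP/ffunP => t.
      by rewrite ffunE; apply/eqP; rewrite -[_ == _]negbK h.
    by rewrite (bigD1 t)//= pure// (negbTE gt) !mul0r.
  congr H; apply/funext => t /=; rewrite (bigD1 (g0 t))//= pure// eqxx scale1r.
  by rewrite big1 ?addr0 ?ffunE// => i ig; rewrite pure// (negbTE ig) scale0r.
have [kd|kd] := ltnP k d; last first.
  by apply: (IHk g0) => // t kt; have := leq_trans kd kt; rewrite leqNgt ltn_ord.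
pose t0 := Ordinal kd.
pose y t := \sum_i c t i *: z i.
have yC t : cub (y t) by apply: pseudocubical_sum.
pose ci i t := if t == t0 then (fun j => (j == i)%:R) else c t.
have -> : H (fun t => \sum_i c t i *: z i) =
    \sum_i c t0 i * H (fun t => \sum_j ci i t j *: z j).
  have -> : (fun t => \sum_i c t i *: z i) = [eta y with t0 |-> \sum_i c t0 i *: z i] :> ('I_d -> W).
    by apply/funext => t /=; case: eqP => // ->.
  rewrite multilinear_sum//; apply: eq_bigr => i _; congr (_ * H _).
  apply/funext => t; rewrite /ci /=; case: eqP => // _.
  by rewrite (bigD1 i)//= eqxx scale1r big1 ?addr0// => j /negbTE ->; rewrite scale0r.
under eq_bigr => i _.
  rewrite (IHk (fun t => if t == t0 then i else g0 t)); first over.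
  - by move=> t j; rewrite /ci; case: eqP.
  - move=> t kt j; rewrite /ci; case: eqP => // /eqP tt0.
    by rewrite pure// ltn_neqAle kt andbT eq_sym.
under eq_bigr do rewrite mulr_sumr.
rewrite exchange_big; apply: eq_bigr => g _ /=.
under eq_bigr do rewrite mulrA.
rewrite -mulr_suml; congr (_ * _).
rewrite (bigD1 (g t0))//= [X in _ + X]big1 ?addr0 => [|i ig]; last first.
  by rewrite (bigD1 t0)//= /ci eqxx eq_sym (negbTE ig) mul0r mulr0.
rewrite (bigD1 t0)//= [in RHS](bigD1 t0)//= /ci eqxx eqxx mul1r; congr (_ * _).
by apply: eq_bigr => t /negbTE ->.
Qed.

(** Expanding over words and applying inclusion-exclusion leaves the permutations, each contributing
    [H z] by symmetry. The right-hand side involves diagonal values only. *)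
Lemma polarization_formula (z : 'I_d -> W) : cub_symmetric ip H -> (forall i, cub (z i)) ->
  (d`!)%:R * H z = \sum_S subset_sign R S * H (fun=> \sum_i (S i)%:R *: z i).
Proof.
move=> H_sym zC.
under eq_bigr => S _ do rewrite (multilinear_expand (c := fun _ i => (S i)%:R))//.
rewrite polarization -sum_injective_const; apply: eq_bigr => g /injectiveP ginj.
rewrite (H_sym z (perm ginj))//; congr H; apply/funext => t /=.
by rewrite permE.
Qed.

End MultilinearExpansion.

Theorem proposition3p1 (R : realType) (N : vectType R) (d : nat)
    (Sigma : marked_fan N) (hpure : d_fan Sigma d) (hsimp : simplicial Sigma)
    (ip : {dot N for idfun}) (omega : cones_of_dim (cones Sigma) d -> R)
    (homega : forall s, 0 < omega s) :
  [/\ cub_symmetric ip (mvol_fan ip omega),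
      cub_multilinear ip (mvol_fan ip omega),
      cub_diagonal ip omega (mvol_fan ip omega) &
      forall F : ('I_d -> ray Sigma -> R) -> R,
        (forall z, (forall i, pseudocubical ip (z i)) -> 0 <= F z) ->
        cub_symmetric ip F -> cub_multilinear ip F -> cub_diagonal ip omega F ->
        forall z, (forall i, pseudocubical ip (z i)) -> F z = mvol_fan ip omega z].
Proof.
have mv (s : cones_of_dim (cones Sigma) d) := mvol_coneP hsimp ip (set_valP s).
have poly (s : cones_of_dim (cones Sigma) d) (z : ray Sigma -> R) : pseudocubical ip z ->
    polytope_in (lin_span (val s)) (cub_polytope ip (val s) z).
  have [Ss _] := set_valP s.
  have [m [r [[dm rinj] rays_s r_line ind su]]] := simplicial_cone_rays hsimp Ss.
  exact: (polytope_cub_polytope Ss rays_s r_line ind su).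
(* Finiteness turns the sum over maximal cones into an ordinary one, for linearity. *)
have fin : finite_set [set: cones_of_dim (cones Sigma) d].
  have -> : [set: cones_of_dim (cones Sigma) d] = val @^-1` cones_of_dim (cones Sigma) d.
    by apply/seteqP; split=> // s _; exact: set_valP.
  apply: finite_preimage; first by move=> s s' _ _; exact: val_inj.
  by apply: sub_finite_set (cones_finite Sigma) => s [].
have sym : cub_symmetric ip (mvol_fan ip omega).
  move=> z p zC; apply: eq_fsbigr => s _; congr (_ * _).
  have [msym _ _] := mv s.
  by rewrite -(msym _ p) => [//|i]; exact: poly.
have lin : cub_multilinear ip (mvol_fan ip omega).
  move=> i z z' lambda zC z'C l0; rewrite /mvol_fan !fsbig_finite//= mulr_sumr -big_split.
  apply: eq_bigr => s _.
  have [_ mlin _] := mv s; have [Ss _] := set_valP s.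
  have [m [r [[dm rinj] rays_s r_line ind su]]] := simplicial_cone_rays hsimp Ss.
  pose P (zz : 'I_d -> ray Sigma -> R) j := cub_polytope ip (val s) (zz j).
  have PE x : P [eta z with i |-> x] =
      [eta P z with i |-> cub_polytope ip (val s) x] :> ('I_d -> set N).
    by apply/funext => j; rewrite /P /=; case: eqP.
  have := mlin (P z) i (cub_polytope ip (val s) z') lambda 1
    (fun j => poly s _ (zC j)) (poly s _ z'C) l0 ler01.
  rewrite -(cub_polytope_comb Ss rays_s r_line ind su (zC i) z'C l0) -!PE mul1r => E.
  transitivity (omega s * (lambda * mvol_cone Sigma ip (val s) (P z) +
      mvol_cone Sigma ip (val s) (P [eta z with i |-> z']))); last by rewrite mulrDr mulrCA.
  by rewrite -E.
have diag : cub_diagonal ip omega (mvol_fan ip omega).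
  move=> z zC; apply: eq_fsbigr => s _; congr (_ * _).
  by have [_ _ mdiag] := mv s; rewrite mdiag//; exact: poly.
split=> // F _ Fsym Flin Fdiag z zC.
have d0 : (d`!)%:R != 0 :> R by rewrite pnatr_eq0 -lt0n fact_gt0.
(* Both sides become the same signed sum of diagonal values, where each function equals
   [vol_fan]. *)
apply: (mulfI d0); rewrite (polarization_formula hsimp Flin Fsym zC).
rewrite (polarization_formula hsimp lin sym zC).
apply: eq_bigr => S _; congr (_ * _).
have SC : pseudocubical ip (\sum_i (S i)%:R *: z i).
  by apply: pseudocubical_sum.
by rewrite Fdiag// diag.
Qed.
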